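(* Let $\mathcal{A}$ be a unital $C^*$-algebra. Then $\mathcal{M}\Phi_+(H_{\mathcal{A}}) \setminus \mathcal{M}\Phi(H_{\mathcal{A}})$ is a two-sided ideal in the multiplicative semigroup $\mathcal{M}\Phi_+(H_{\mathcal{A}})$, and $\mathcal{M}\Phi_-(H_{\mathcal{A}}) \setminus \mathcal{M}\Phi(H_{\mathcal{A}})$ is a two-sided ideal in the multiplicative semigroup $\mathcal{M}\Phi_-(H_{\mathcal{A}})$; that is, for each sign $\pm$, if $F, D \in \mathcal{M}\Phi_\pm(H_{\mathcal{A}})$ and at least one of $F, D$ is not in $\mathcal{M}\Phi(H_{\mathcal{A}})$, then $DF \in \mathcal{M}\Phi_\pm(H_{\mathcal{A}}) \setminus \mathcal{M}\Phi(H_{\mathcal{A}})$. In particular, both sets are semigroups under multiplication.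
   Context: $\mathcal{A}$ is a unital $C^*$-algebra; $H_{\mathcal{A}} = \ell^2(\mathcal{A})$ is the standard Hilbert $\mathcal{A}$-module, and $B^a(H_{\mathcal{A}})$ is the $C^*$-algebra of bounded adjointable $\mathcal{A}$-linear operators on it. $M \tilde\oplus N$ denotes a direct sum of closed submodules that is not necessarily orthogonal. A Hilbert module is finitely generated if it is the (algebraic) $\mathcal{A}$-linear span of a finite set. An isomorphism of Hilbert modules is a bounded $\mathcal{A}$-linear bijection (with bounded inverse). Multiplication is composition of operators. ''Two-sided ideal'' is meant in the sense of semigroups (the empty set is allowed). For $F \in B^a(H_{\mathcal{A}})$ consider closed submodules with $H_{\mathcal{A}} = M_1 \tilde\oplus N_1 = M_2 \tilde\oplus N_2$, $F(M_1) \subseteq M_2$, $F(N_1) \subseteq N_2$ and $F|_{M_1}: M_1 \to M_2$ an isomorphism. $F \in \mathcal{M}\Phi_+(H_{\mathcal{A}})$ if such a decomposition exists with $N_1$ finitely generated; $F \in \mathcal{M}\Phi_-(H_{\mathcal{A}})$ if such a decomposition exists with $N_2$ finitely generated; $F \in \mathcal{M}\Phi(H_{\mathcal{A}})$ if a single such decomposition exists with both $N_1$ and $N_2$ finitely generated. *)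

(* Defs.v *)
From HB Require Import structures.
From mathcomp Require Import all_boot all_order all_algebra.
From mathcomp Require Import complex.
From mathcomp Require Import boolp classical_sets functions reals topology.
From mathcomp Require Import normedtype sequences.

Set Implicit Arguments.
Unset Strict Implicit.
Unset Printing Implicit Defensive.

Import Order.TTheory GRing.Theory Num.Theory numFieldNormedType.Exports.

Local Open Scope classical_set_scope.
Local Open Scope ring_scope.
Local Open Scope complex_scope.

(* The product is a field of the mixin, and not the one of an algType,        *)
(* because no structure can inherit both from GRing.PzSemiRing and from       *)
(* Num.SemiNormedZmodule besides those below Num.NumDomain. Norms take their  *)
(* values in R[i], where 0 <= z means that z is real and nonnegative.         *)
HB.mixin Record NormedModule_isCstarAlgebra (R : realType) A
    of CompleteNormedModule R[i] A := {
  cone : A ;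
  cmul : A -> A -> A ;
  star : A -> A ;
  cmulA : associative cmul ;
  cmul1l : left_id cone cmul ;
  cmul1r : right_id cone cmul ;
  cmulDl : left_distributive cmul +%R ;
  cmulDr : right_distributive cmul +%R ;
  cmulZl : forall (c : R[i]) (x y : A), cmul (c *: x) y = c *: cmul x y ;
  cmulZr : forall (c : R[i]) (x y : A), cmul x (c *: y) = c *: cmul x y ;
  starD : {morph star : x y / x + y} ;
  starZ : forall (c : R[i]) (x : A), star (c *: x) = Num.conj c *: star x ;
  starM : forall x y : A, star (cmul x y) = cmul (star y) (star x) ;
  starK : involutive star ;
  cnorm_mul : forall x y : A, `|cmul x y| <= `|x| * `|y| ;
  cnorm_star_mul : forall x : A, `|cmul (star x) x| = `|x| ^+ 2
}.

#[short(type="cstarAlgType")]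
HB.structure Definition CstarAlgebra (R : realType) :=
  {A of CompleteNormedModule R[i] A & NormedModule_isCstarAlgebra R A}.

Local Notation "x *c y" := (cmul x y) (at level 40, left associativity).

Section StandardModule.
Context {R : realType} {A : cstarAlgType R}.

(* The standard module l^2(A) is a set of sequences, and an operator on it is *)
(* represented by a function on all sequences. Every predicate below inspects *)
(* such a function on l^2(A) only.                                            *)
Local Notation hseq := (nat -> A).

Definition ell2 : set hseq :=
  [set x | cvgn (series (fun n => star (x n) *c x n))].

Definition hinner (x y : hseq) : A :=
  limn (series (fun n => star (x n) *c y n)).

Definition hnorm (x : hseq) : R[i] := sqrtC `|hinner x x|.

(* Hilbert modules are right modules. *)
Definition hact (x : hseq) (a : A) : hseq := fun n => x n *c a.

Definition submodule (M : set hseq) : Prop :=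
  [/\ M `<=` ell2, M 0, forall x y, M x -> M y -> M (x + y)
    & forall x a, M x -> M (hact x a)].

Definition hclosed (M : set hseq) : Prop :=
  forall x, ell2 x ->
    (forall e : R[i], 0 < e -> exists2 y, M y & hnorm (x - y) < e) -> M x.

Definition closed_submodule (M : set hseq) : Prop := submodule M /\ hclosed M.

Definition finitely_generated (M : set hseq) : Prop :=
  exists (k : nat) (g : 'I_k -> hseq),
    M = [set x | exists a : 'I_k -> A, x = \sum_(i < k) hact (g i) (a i)].

(* l^2(A) is the algebraic direct sum of M and N. *)
Definition direct_sum (M N : set hseq) : Prop :=
  forall x, ell2 x ->
    exists! p : hseq * hseq, [/\ M p.1, N p.2 & x = p.1 + p.2].

Definition linear_on (M : set hseq) (F : hseq -> hseq) : Prop :=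
  (forall x y, M x -> M y -> F (x + y) = F x + F y) /\
  (forall x a, M x -> F (hact x a) = hact (F x) a).

Definition bounded_on (M : set hseq) (F : hseq -> hseq) : Prop :=
  exists C : R[i], forall x, M x -> hnorm (F x) <= C * hnorm x.

Definition adjointable (F : hseq -> hseq) : Prop :=
  exists2 G : hseq -> hseq, set_fun ell2 ell2 G &
    forall x y, ell2 x -> ell2 y -> hinner (F x) y = hinner x (G y).

(* B^a(l^2(A)) *)
Definition Ba : set (hseq -> hseq) :=
  [set F | [/\ set_fun ell2 ell2 F, linear_on ell2 F, bounded_on ell2 F
             & adjointable F]].

Definition isomorphism (M N : set hseq) (F : hseq -> hseq) : Prop :=
  [/\ set_bij M N F, linear_on M F, bounded_on M F
    & exists C : R[i], forall x, M x -> hnorm x <= C * hnorm (F x)].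

Definition decomposition (F : hseq -> hseq) (M1 N1 M2 N2 : set hseq) : Prop :=
  [/\ [/\ closed_submodule M1, closed_submodule N1,
          closed_submodule M2 & closed_submodule N2],
      direct_sum M1 N1, direct_sum M2 N2,
      set_fun N1 N2 F & isomorphism M1 M2 F].

Definition MPhi_plus : set (hseq -> hseq) :=
  [set F | Ba F /\ exists M1 N1 M2 N2,
     decomposition F M1 N1 M2 N2 /\ finitely_generated N1].

Definition MPhi_minus : set (hseq -> hseq) :=
  [set F | Ba F /\ exists M1 N1 M2 N2,
     decomposition F M1 N1 M2 N2 /\ finitely_generated N2].

Definition MPhi : set (hseq -> hseq) :=
  [set F | Ba F /\ exists M1 N1 M2 N2,
     [/\ decomposition F M1 N1 M2 N2, finitely_generated N1
       & finitely_generated N2]].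

End StandardModule.

Definition mul_semigroup (T : Type) (S : set (T -> T)) : Prop :=
  forall F D, S F -> S D -> S (D \o F).

(* The empty set is allowed as an ideal. *)
Definition two_sided_ideal (T : Type) (S I : set (T -> T)) : Prop :=
  [/\ mul_semigroup S, I `<=` S
    & forall F D, S F -> S D -> I F \/ I D -> I (D \o F)].

(* Main.v *)
From HB Require Import structures.
From mathcomp Require Import all_boot all_order all_algebra.
From mathcomp Require Import complex.
From mathcomp Require Import boolp classical_sets functions reals topology.
From mathcomp Require Import normedtype sequences.
From mathcomp Require Import lra.
Require Import Defs.

Set Implicit Arguments.
Unset Strict Implicit.
Unset Printing Implicit Defensive.

Import Order.TTheory GRing.Theory Num.Theory numFieldNormedType.Exports.

Local Open Scope classical_set_scope.
Local Open Scope ring_scope.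
Local Open Scope complex_scope.

(** Call an adjointable operator f left invertible modulo finite rank when
    some adjointable g makes 1 - g f an operator of finite rank, that is
    x |-> sum_i g_i <h_i, x>, and define right invertibility in the same way.
    Finite rank operators form a two-sided ideal, so these are one-sided
    invertibility notions of a quotient semigroup. The three lemmas MPhi_plusP,
    MPhi_minusP and MPhiP identify MPhi_plus, MPhi_minus and MPhi with the left
    invertible, the right invertible and the left and right invertible
    operators. The theorem is then elementary algebra: if d is left invertible
    and d f has a right inverse, then d is invertible, hence so is f
    (right_invertible_factors); dually for right invertible f
    (left_invertible_factors).

    From invertibility to a decomposition. If g f = 1 - k with k of finite rank,
    then k is small on the sequences that vanish in the first n coordinates, so
    that f is bounded below there and has an exact left inverse on them. This
    produces h with h f h = h and 1 - h f of finite rank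
    (left_regularization). For such an outer inverse h, the idempotents h f and
    f h decompose the module with respect to f: f is an isomorphism from the
    range of h f onto the range of f h, and maps kernel to kernel
    (outer_inverse_decomposition). The range of a finite rank idempotent is
    finitely generated.

    From a decomposition to invertibility. The summands are only closed and need
    not be orthogonal, and two facts bridge the gap. First, the projections of a
    direct sum of closed submodules are bounded (direct_sum_bounded). Second, an
    adjointable U with closed range has a generalized inverse: U W U = U for an
    adjointable W (closed_range_inverse). Applied to an operator whose range is a
    finitely generated summand N, the second fact gives a finite rank idempotent
    U W onto N; applied to the restriction of f to the kernel of U W, or to the
    compression of f to it, it gives the wanted one-sided inverse.

    The generalized inverse is obtained without functional calculus. For T = U U^*
    of norm at most one, surjectivity of U onto its closed range N gives
    |y| <= C |U^* y| on N, while the telescoping sum of the forms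
    <x, (1 - T)^l T x> gives (2 n + 1) |U^* (1 - T)^n x|^2 <= |x|^2. Together they
    make (1 - T)^n tend to zero on N, so that T is invertible on N by a Neumann
    series.

    All this rests on the Cauchy-Schwarz inequality, hence on the positivity of
    x^* x in a C*-algebra (pos_star_mul), which is proved here from the axioms
    using only norm estimates and square roots. *)

(** * Equalities in abelian groups *)

(** Reflected expressions: noncommutative products occur throughout as atoms,
    where a tactic for commutative rings does not apply. *)
Inductive zexp := ZVar of nat | ZZero | ZAdd of zexp & zexp | ZOpp of zexp.

Fixpoint zeval (V : zmodType) (env : seq V) e : V :=
  match e with
  | ZVar i => env`_i
  | ZZero => 0
  | ZAdd e1 e2 => zeval env e1 + zeval env e2
  | ZOpp e1 => - zeval env e1
  end.

Fixpoint zcoef e (i : nat) : int :=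
  match e with
  | ZVar j => (j == i)%:Z
  | ZZero => 0
  | ZAdd e1 e2 => zcoef e1 i + zcoef e2 i
  | ZOpp e1 => - zcoef e1 i
  end.

Lemma zevalE (V : zmodType) (env : seq V) e :
  zeval env e = \sum_(i < size env) env`_i *~ zcoef e i.
Proof.
elim: e => [j||e1 IH1 e2 IH2|e1 IH1] /=.
- case: (ltnP j (size env)) => [jn|nj].
    rewrite (bigD1 (Ordinal jn))//= eqxx mulr1z big1 ?addr0// => i.
    by rewrite -val_eqE/= eq_sym => /negbTE ->; rewrite mulr0z.
  rewrite nth_default// big1// => i _.
  by rewrite gtn_eqF ?mulr0z// (leq_trans (ltn_ord i)).
- by rewrite big1// => i _; rewrite mulr0z.
- by rewrite IH1 IH2 -big_split; apply: eq_bigr => i _; rewrite mulrzDr.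
- by rewrite IH1 -sumrN; apply: eq_bigr => i _; rewrite mulrNz.
Qed.

Lemma zeval_eq (V : zmodType) (env : seq V) e1 e2 :
  all (fun i => zcoef e1 i == zcoef e2 i) (iota 0 (size env)) ->
  zeval env e1 = zeval env e2.
Proof.
move=> /allP e12; rewrite !zevalE; apply: eq_bigr => i _.
by congr (_ *~ _); apply/eqP/e12; rewrite mem_iota /=.
Qed.

(** Atoms are compared up to conversion, because the same product is often
    reached through different paths of the algebraic hierarchy. *)
Ltac zindex a l :=
  match l with
  | ?b :: _ => let _ := match goal with _ => unify a b end in constr:(0%N)
  | _ :: ?l' => let n := zindex a l' in constr:(S n)
  end.
Ltac zmem a l :=
  match l with
  | ?b :: _ => let _ := match goal with _ => unify a b end in constr:(true)
  | _ :: ?l' => zmem a l'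
  | _ => constr:(false)
  end.
Ltac zatoms l t :=
  lazymatch t with
  | (?x + ?y)%R => let l := zatoms l x in zatoms l y
  | (- ?x)%R => zatoms l x
  | 0%R => l
  | _ => lazymatch zmem t l with true => l | false => constr:(t :: l) end
  end.
Ltac zreify l t :=
  lazymatch t with
  | (?x + ?y)%R => let a := zreify l x in let b := zreify l y in constr:(ZAdd a b)
  | (- ?x)%R => let a := zreify l x in constr:(ZOpp a)
  | 0%R => constr:(ZZero)
  | _ => let n := zindex t l in constr:(ZVar n)
  end.
Ltac abel :=
  lazymatch goal with
  | |- @eq ?V ?x ?y =>
    let l := zatoms (@nil V) x in let l := zatoms l y in
    let a := zreify l x in let b := zreify l y in
    exact: (@zeval_eq _ l a b isT)
  end.

(** * Null sequences and convergence in normed groups *)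

Section NullSequences.
Context {R : realType}.
Implicit Types a b : nat -> R.

Definition null b := b @ \oo --> (0 : R).

Lemma null_squeeze b a : null b -> (forall n, 0 <= a n <= b n) -> null a.
Proof.
move=> b0 ab; apply: (squeeze_cvgr _ (cvg_cst 0) b0).
by apply: nearW => n; apply: ab.
Qed.

Lemma null_add a b : null a -> null b -> null (fun n => a n + b n).
Proof. by move=> a0 b0; rewrite /null -[X in _ --> X]addr0; apply: cvgD. Qed.

Lemma null_scale c b : null b -> null (fun n => c * b n).
Proof. by move=> b0; rewrite /null -[X in _ --> X](mulr0 c); apply: cvgMr. Qed.

Lemma null_shift k b : null b -> null (fun n => b (n + k)%N).
Proof. by move=> b0; rewrite /null (cvg_shiftn k). Qed.

Lemma le_null c d b : null b -> (forall n, c <= d + b n) -> c <= d.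
Proof.
move=> b0 cdb; have cvg_d : (fun n => d + b n) @ \oo --> d.
  by rewrite -[X in _ --> X]addr0; apply: cvgD => //; apply: cvg_cst.
rewrite -(cvg_lim _ cvg_d) //; apply: limr_ge; first by apply: cvgP cvg_d.
by apply: nearW => n; apply: cdb.
Qed.

Lemma nullP b : (forall n, 0 <= b n) ->
  null b <-> (forall e, 0 < e -> exists N, forall n, (N <= n)%N -> b n <= e).
Proof.
move=> b_ge0; split => [/cvgrPdist_le b0 e /b0 [N _ bN]|bP].
  by exists N => n /bN /=; rewrite sub0r normrN ger0_norm.
apply/cvgrPdist_le => e /bP [N bN]; exists N => //= n /bN.
by rewrite sub0r normrN ger0_norm.
Qed.

Lemma null_geometric c z : 0 <= z < 1 -> null (fun n => c * z ^+ n).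
Proof.
move=> /andP[z0 z1]; apply: null_scale.
by apply: cvg_expr; rewrite ger0_norm.
Qed.

End NullSequences.

(** Algebra elements and module elements are both measured by a real valued norm
    that is not attached to their type; convergence for such a norm is therefore
    expressed through real null sequences. *)
Section NormedGroups.
Context {R : realType} {V : zmodType}.
Variable nu : V -> R.

Definition group_norm :=
  [/\ nu 0 = 0, forall x, nu (- x) = nu x,
      forall x y, nu (x + y) <= nu x + nu y & forall x, nu x = 0 -> x = 0].

Definition converges (u : nat -> V) (l : V) := null (fun n => nu (u n - l)).

(** A Cauchy condition with an explicit modulus b, the form in which most of the
    estimates below provide it. *)
Definition norm_complete := forall (u : nat -> V) (b : nat -> R), null b ->
  (forall n m, (n <= m)%N -> nu (u m - u n) <= b n) -> exists l, converges u l.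

Hypothesis nuP : group_norm.

Lemma gnorm0 : nu 0 = 0. Proof. by case: nuP. Qed.

Lemma gnormN x : nu (- x) = nu x. Proof. by case: nuP. Qed.

Lemma gnormD x y : nu (x + y) <= nu x + nu y. Proof. by case: nuP. Qed.

Lemma gnormB x y : nu (x - y) <= nu x + nu y.
Proof. by rewrite -(gnormN y) gnormD. Qed.

Lemma gnorm_distC x y : nu (x - y) = nu (y - x).
Proof. by rewrite -gnormN opprB. Qed.

Lemma gnorm_ge0 x : 0 <= nu x.
Proof.
by have := gnormB x x; rewrite subrr gnorm0; lra.
Qed.

Lemma gnorm_eq0 x : nu x <= 0 -> x = 0.
Proof. by case: nuP => _ _ _ + x0; apply; apply/le_anti; rewrite x0 gnorm_ge0. Qed.

Lemma gnorm_triangle y x z : nu (x - z) <= nu (x - y) + nu (y - z).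
Proof. by apply: le_trans (gnormD _ _); rewrite addrA subrK. Qed.

Lemma gnorm_sum (I : Type) (s : seq I) (P : pred I) (F : I -> V) :
  nu (\sum_(i <- s | P i) F i) <= \sum_(i <- s | P i) nu (F i).
Proof.
elim/big_rec2: _ => [|i y x _ le_xy]; first by rewrite gnorm0.
by rewrite (le_trans (gnormD _ _))// lerD2l.
Qed.

Lemma converges_le u l z c b :
  converges u l -> null b -> (forall n, nu (u n - z) <= c + b n) -> nu (l - z) <= c.
Proof.
move=> ul b0 uz; apply: (le_null (null_add ul b0)) => n.
by rewrite (le_trans (gnorm_triangle (u n) _ _))// gnorm_distC addrCA lerD2l.
Qed.

Lemma converges_unique u l l' : converges u l -> converges u l' -> l = l'.
Proof.
move=> ul ul'; apply/subr0_eq/gnorm_eq0.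
by apply: (converges_le ul ul') => n; rewrite add0r.
Qed.

Lemma convergesP u l b : null b -> (forall n, nu (u n - l) <= b n) -> converges u l.
Proof. by move=> b0 ub; apply: null_squeeze b0 _ => n; rewrite gnorm_ge0 ub. Qed.

Lemma converges_cst l : converges (fun=> l) l.
Proof. by rewrite /converges subrr gnorm0; apply: cvg_cst. Qed.

Lemma convergesD u v l k :
  converges u l -> converges v k -> converges (fun n => u n + v n) (l + k).
Proof.
move=> ul vk; apply: convergesP (null_add ul vk) _ => n.
by rewrite opprD addrACA gnormD.
Qed.

Lemma convergesN u l : converges u l -> converges (fun n => - u n) (- l).
Proof. by move=> ul; apply: convergesP ul _ => n; rewrite -opprD gnormN. Qed.

Lemma convergesB u v l k :
  converges u l -> converges v k -> converges (fun n => u n - v n) (l - k).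
Proof. by move=> ul vk; apply: convergesD => //; apply: convergesN. Qed.

Lemma converges_shift k u l : converges u l -> converges (fun n => u (n + k)%N) l.
Proof. exact: (@null_shift _ k (fun n => nu (u n - l))). Qed.

Lemma converges_tail_le u l n b :
  converges u l -> (forall m, (n <= m)%N -> nu (u m - u n) <= b) -> nu (l - u n) <= b.
Proof.
move=> /(converges_shift n) ul ub.
apply: (converges_le ul (cvg_cst 0)) => m; rewrite addr0; apply: ub.
exact: leq_addl.
Qed.

End NormedGroups.

(** * The C*-algebra as a ring with real scalars *)

Section Calg.
Context {R : realType}.

(** A copy of the algebra that carries the ring structure and the real module
    structure. The complex scalars survive only as the central element ci. *)
Definition calg (A : cstarAlgType R) : Type := A.

Context {A : cstarAlgType R}.

HB.instance Definition _ := GRing.Zmodule.copy (calg A) A.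

HB.instance Definition _ := GRing.Zmodule_isPzRing.Build (calg A)
  (@cmulA R A) (@cmul1l R A) (@cmul1r R A) (@cmulDl R A) (@cmulDr R A).

Definition real_scale (r : R) (a : calg A) : calg A := (r%:C *: (a : A)).

Fact real_scaleA a b v : real_scale a (real_scale b v) = real_scale (a * b) v.
Proof. by rewrite /real_scale scalerA -rmorphM. Qed.

Fact real_scale1 : left_id 1 real_scale.
Proof. by move=> v; rewrite /real_scale scale1r. Qed.

Fact real_scaleDr : right_distributive real_scale +%R.
Proof. by move=> a u v; rewrite /real_scale scalerDr. Qed.

Fact real_scaleDl v : {morph real_scale^~ v : a b / a + b}.
Proof. by move=> a b; rewrite /real_scale rmorphD scalerDl. Qed.

HB.instance Definition _ := GRing.Zmodule_isLmodule.Build R (calg A)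
  real_scaleA real_scale1 real_scaleDr real_scaleDl.

Local Notation T := (calg A).
Implicit Types (x y z a b c : T) (r s t : R).

Definition st x : T := star (x : A).
Definition nm x : R := complex.Re (`| (x : A) |).
Definition ci : T := 'i%C *: (@cone R A).

Lemma normE x : `| (x : A) | = (nm x)%:C.
Proof.
rewrite /nm; have := normr_ge0 (x : A).
by case: `| _ | => a b; rewrite lecE /= => /andP[/eqP->].
Qed.

Lemma nm_group_norm : group_norm nm.
Proof.
split.
- by rewrite /nm normr0.
- by move=> x; rewrite /nm normrN.
- by move=> x y; rewrite -lecR rmorphD/= -!normE ler_normD.
- by move=> x x0; apply/eqP; rewrite -(@normr_eq0 _ A) normE x0.
Qed.

Lemma nm_ge0 x : 0 <= nm x. Proof. exact: gnorm_ge0 nm_group_norm x. Qed.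
Lemma nm0 : nm 0 = 0. Proof. exact: gnorm0 nm_group_norm. Qed.
Lemma nmN x : nm (- x) = nm x. Proof. exact: gnormN nm_group_norm x. Qed.
Lemma nmD x y : nm (x + y) <= nm x + nm y. Proof. exact: gnormD nm_group_norm x y. Qed.
Lemma nmB x y : nm (x - y) <= nm x + nm y. Proof. exact: gnormB nm_group_norm x y. Qed.
Lemma nm_eq0 x : nm x <= 0 -> x = 0. Proof. by move=> /(gnorm_eq0 nm_group_norm). Qed.

Lemma nmM x y : nm (x * y) <= nm x * nm y.
Proof. by rewrite -lecR rmorphM/= -!normE cnorm_mul. Qed.

Lemma nmZ r x : nm (r *: x) = `|r| * nm x.
Proof.
apply: complexI; rewrite -normE normrZ rmorphM/= -normE normc_def/=.
by rewrite expr0n/= addr0 sqrtr_sqr.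
Qed.

Lemma nmC x : nm (st x * x) = nm x ^+ 2.
Proof. by apply: complexI; rewrite -normE rmorphXn/= -normE cnorm_star_mul. Qed.

Lemma scaleAl r x y : r *: (x * y) = (r *: x) * y.
Proof. by rewrite -[RHS]/(cmul (r%:C *: (x : A)) y) cmulZl. Qed.

Lemma scaleAr r x y : r *: (x * y) = x * (r *: y).
Proof. by rewrite -[RHS]/(cmul (x : A) (r%:C *: (y : A))) cmulZr. Qed.

Lemma stD x y : st (x + y) = st x + st y. Proof. exact: starD. Qed.
Lemma stK : involutive st. Proof. exact: starK. Qed.
Lemma stM x y : st (x * y) = st y * st x. Proof. exact: starM. Qed.

Lemma stZ r x : st (r *: x) = r *: st x.
Proof. by rewrite -[LHS]/(star (r%:C *: (x : A))) starZ -[Num.conj _]/(conjc _) conjc_real. Qed.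

HB.instance Definition _ := GRing.isSemilinear.Build R T T *:%R st (stZ, stD).

Lemma st1 : st 1 = 1.
Proof. by rewrite -[LHS]mulr1 -{2}(stK 1) -stM mulr1 stK. Qed.

(** The C*-identity gives |x|^2 <= |x^*| |x|, hence |x| <= |x^*|, and the
    involution gives the converse. *)
Lemma nm_st x : nm (st x) = nm x.
Proof.
wlog : x / nm (st x) < nm x => [le_st|lt_x].
  case: (ltgtP (nm (st x)) (nm x)) => // [/le_st//|lt_x].
  by rewrite -[LHS]le_st ?stK.
have x0 : 0 < nm x by rewrite (le_lt_trans _ lt_x)// nm_ge0.
have := nmM (st x) x.
by rewrite nmC expr2 ler_pM2r// leNgt lt_x.
Qed.

(** The zero algebra is allowed, so that the norm of 1 may be 0. *)
Lemma nm1_le1 : nm 1 <= 1.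
Proof.
rewrite leNgt; apply/negP => lt1; have := nmC 1.
by rewrite st1 mulr1 => e; nra.
Qed.

Lemma nmX x n : nm (x ^+ n) <= nm x ^+ n.
Proof.
elim: n => [|n IHn]; first by rewrite !expr0 nm1_le1.
by rewrite !exprS (le_trans (nmM _ _))// ler_wpM2l ?nm_ge0.
Qed.

Lemma ci_mul x : ci * x = 'i%C *: (x : A).
Proof. by rewrite -[LHS]/(cmul ('i%C *: (@cone R A)) x) cmulZl cmul1l. Qed.

Lemma mul_ci x : x * ci = ci * x.
Proof. by rewrite -[LHS]/(cmul x ('i%C *: (@cone R A))) cmulZr cmul1r ci_mul. Qed.

Lemma ci2 : ci * ci = - 1.
Proof. by rewrite ci_mul scalerA -expr2 sqr_i scaleN1r. Qed.

Lemma st_ci : st ci = - ci.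
Proof.
have conj_i : Num.conj ('i%C : R[i]) = - 'i%C.
  by apply/eqP; rewrite eq_complex /= oppr0 !eqxx.
by rewrite -[LHS]/(star ('i%C *: (@cone R A))) starZ conj_i scaleNr -[star _]/(st 1) st1.
Qed.

Lemma cvg_converges (u : nat -> T) (l : T) :
  ((u : nat -> A) @ \oo --> (l : A)) <-> converges nm u l.
Proof.
rewrite /converges nullP => [|n]; last exact: nm_ge0.
split=> [/cvgrPdist_le ul e e0|ulP].
  have /ul[N _ uN] : 0 < e%:C by rewrite ltcR.
  by exists N => n /uN /=; rewrite distrC -[_ - _]/(u n - l : T) normE lecR.
apply/cvgrPdist_le => -[e i]; rewrite ltcE/= => /andP[/eqP-> /ulP[N uN]].
exists N => // n /uN /=; rewrite distrC -[`| _ - _ |]/(`| u n - l : A |).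
by rewrite normE lecR.
Qed.

Lemma nm_complete_eps (u : nat -> T) :
  (forall e, 0 < e -> exists N, forall n m, (N <= n <= m)%N -> nm (u m - u n) <= e) ->
  exists l, converges nm u l.
Proof.
move=> uP.
have /cauchy_cvgP cvg_u : cauchy ((u : nat -> A) @ \oo).
  apply: cauchy_exP => -[e i]; rewrite ltcE/= => /andP[/eqP-> e0].
  have [|N uN] := uP (e / 2); first by rewrite divr_gt0.
  exists (u N); exists N => // n /= Nn.
  rewrite -ball_normE /ball_/= distrC -[`| _ - _ |]/(`| u n - u N : A |) normE ltcR.
  by rewrite (le_lt_trans (uN _ _ _))//; [rewrite leqnn | lra].
by exists (lim ((u : nat -> A) @ \oo)); apply/cvg_converges.
Qed.

Lemma nm_complete : norm_complete nm.
Proof.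
move=> u b b0 ub; apply: nm_complete_eps => e e0.
have b_ge0 n : 0 <= b n by rewrite (le_trans _ (ub n n _))// nm_ge0.
have [N bN] := (nullP b_ge0).1 b0 _ e0.
by exists N => n m /andP[Nn nm]; rewrite (le_trans (ub _ _ nm))// bN.
Qed.

Lemma convergesM u v x y :
  converges nm u x -> converges nm v y -> converges nm (fun n => u n * v n) (x * y).
Proof.
move=> ux vy.
have [C uC] : exists C, forall n, nm (u n) <= C.
  have /cvgP/cvg_seq_bounded[C [_ uC]] := ux.
  exists (C + 1 + nm x) => n; rewrite -[u n](subrK x) (le_trans (nmD _ _))// lerD2r.
  by have := uC (C + 1) _ n I; rewrite ltrDl ltr01 => /(_ isT); apply: le_trans; rewrite ler_norm.
apply: (convergesP nm_group_norm (null_add (null_scale C vy) (null_scale (nm y) ux))) => n.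
have -> : u n * v n - x * y = u n * (v n - y) + (u n - x) * y.
  by rewrite mulrBr mulrBl addrA subrK.
rewrite (le_trans (nmD _ _))// lerD// (le_trans (nmM _ _))//.
  by rewrite ler_wpM2r// nm_ge0.
by rewrite mulrC.
Qed.

Lemma converges_st u x : converges nm u x -> converges nm (fun n => st (u n)) (st x).
Proof.
move=> ux; apply: (convergesP nm_group_norm ux) => n.
by rewrite -linearB nm_st.
Qed.

Lemma convergesZ r u x : converges nm u x -> converges nm (fun n => r *: u n) (r *: x).
Proof.
move=> ux; apply: (convergesP nm_group_norm (null_scale `|r| ux)) => n.
by rewrite -scalerBr nmZ.
Qed.

End Calg.

(** * Positive elements *)

Section SqrtIteration.
Context {R : realType}.

(** The iteration y |-> (x + y^2) / 2 from 0. Its limit satisfies (1 - y)^2 = 1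
    - x. It is stated for an arbitrary ring, because the real iteration with x =
    1 majorizes the one in the algebra. *)
Fixpoint sqrt_iter (V : pzRingType) (half : V -> V) (x : V) n : V :=
  if n is m.+1 then half (x + sqrt_iter half x m ^+ 2) else 0.

Definition sqrt_maj n : R := sqrt_iter (fun t => t / 2) 1 n.

Lemma sqrt_majS n : sqrt_maj n.+1 = (1 + sqrt_maj n ^+ 2) / 2.
Proof. by []. Qed.

Lemma sqrt_maj_itv n : 0 <= sqrt_maj n <= 1.
Proof.
elim: n => [|n /andP[t0 t1]]; first by rewrite /sqrt_maj/= lexx ler01.
by rewrite sqrt_majS expr2; nra.
Qed.

Lemma sqrt_maj_null : exists b, null b /\
  forall n m, (n <= m)%N -> sqrt_maj m - sqrt_maj n <= b n.
Proof.
have t_le n : sqrt_maj n <= sqrt_maj n.+1.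
  have /andP[t0 t1] := sqrt_maj_itv n.
  by rewrite sqrt_majS expr2; nra.
have t_mono : {homo sqrt_maj : n m / (n <= m)%N >-> n <= m}.
  exact: homo_leq (@lexx _ _) (@le_trans _ _) t_le.
have cvg_t : cvgn sqrt_maj.
  apply: nondecreasing_is_cvgn => //; exists 1 => _ [n _ <-].
  by have /andP[] := sqrt_maj_itv n.
exists (fun n => limn sqrt_maj - sqrt_maj n); split=> [|n m _].
  rewrite /null -(subrr (limn sqrt_maj)); apply: cvgB => //; exact: cvg_cst.
by rewrite lerD2r; apply: nondecreasing_cvgn_le.
Qed.

End SqrtIteration.

Section Positivity.
Context {R : realType} {A : cstarAlgType R}.
Local Notation T := (calg A).
Local Notation "r %:A" := (r *: (1 : T)) : ring_scope.
Implicit Types (x y z a b c d s : T) (r t : R).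

Definition sa x := st x = x.

Lemma saD x y : sa x -> sa y -> sa (x + y).
Proof. by rewrite /sa stD => -> ->. Qed.
Lemma saN x : sa x -> sa (- x). Proof. by rewrite /sa linearN /= => ->. Qed.
Lemma saB x y : sa x -> sa y -> sa (x - y).
Proof. by rewrite /sa linearB /= => -> ->. Qed.
Lemma saZ r x : sa x -> sa (r *: x). Proof. by rewrite /sa stZ => ->. Qed.
Lemma sa1 : sa 1. Proof. exact: st1. Qed.
Lemma sa_scalar r : sa r%:A. Proof. exact: saZ sa1. Qed.
Lemma saM x y : sa x -> sa y -> GRing.comm x y -> sa (x * y).
Proof. by rewrite /sa stM => -> ->. Qed.
Lemma saX x n : sa x -> sa (x ^+ n).
Proof.
move=> sax; elim: n => [|n IHn]; first exact: sa1.
by rewrite exprS; apply: saM => //; apply: commrX.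
Qed.

Lemma commZ r x y : GRing.comm x y -> GRing.comm x (r *: y).
Proof. by rewrite /GRing.comm -scaleAr -scaleAl => ->. Qed.

Lemma comm_scalar r x : GRing.comm x r%:A.
Proof. exact/commZ/commr1. Qed.

Lemma nm_sqr b : sa b -> nm (b ^+ 2) = nm b ^+ 2.
Proof. by move=> sab; rewrite -nmC sab expr2. Qed.

Lemma nm_scalar r : nm (r%:A) <= `|r|.
Proof. by rewrite nmZ ler_piMr// nm1_le1. Qed.

Lemma commutator_closed z u x : converges nm u x ->
  (forall n, GRing.comm z (u n)) -> GRing.comm z x.
Proof.
move=> ux zu; apply: (converges_unique nm_group_norm).
  by apply: convergesM ux; apply: converges_cst nm_group_norm _.
have -> : (fun n => z * u n) = (fun n => u n * z) by apply/funext => n; apply: zu.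
by apply: convergesM => //; apply: converges_cst nm_group_norm _.
Qed.

(** Successive differences of the iteration are bounded by those of the real
    iteration at 1, which is increasing and bounded; this gives convergence even
    when x has norm 1. The iterates are polynomials in x, so the limit commutes
    with everything that commutes with x. *)
Lemma sqrt_one_minus x : sa x -> nm x <= 1 -> exists c,
  [/\ sa c, nm (1 - c) <= 1, c ^+ 2 = 1 - x
    & forall z, GRing.comm z x -> GRing.comm z c].
Proof.
move=> sax x1; pose y := sqrt_iter (fun v : T => 2^-1 *: v) x.
have yS n : y n.+1 = 2^-1 *: (x + y n ^+ 2) by [].
have y_comm z : GRing.comm z x -> forall n, GRing.comm z (y n).
  move=> zx; elim=> [|n IHn]; first exact: commr0.
  by rewrite yS; apply/commZ/commrD => //; apply: commrX.
have yy n : GRing.comm (y n) (y n.+1).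
  by apply: (y_comm); apply: commr_sym; apply: y_comm.
have half0 : (0 : R) <= 2^-1 by lra.
have y_le n : nm (y n) <= sqrt_maj n.
  elim: n => [|n IHn]; first by rewrite nm0.
  rewrite yS sqrt_majS nmZ ger0_norm// mulrC ler_wpM2r//.
  rewrite (le_trans (nmD _ _))// lerD// (le_trans (nmX _ _))//.
  by rewrite lerXn2r// nnegrE ?nm_ge0//; have /andP[] := @sqrt_maj_itv R n.
have yS_le n : nm (y n.+1 - y n) <= sqrt_maj n.+1 - sqrt_maj n.
  elim: n => [|n IHn]; first by rewrite subr0 [sqrt_maj 0%N]/sqrt_maj/= subr0 y_le.
  have -> : y n.+2 - y n.+1 = 2^-1 *: ((y n.+1 - y n) * (y n.+1 + y n)).
    by rewrite yS {2}yS -scalerBr mulrDr !mulrBl -(yy n) !expr2; congr (_ *: _); abel.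
  have -> : sqrt_maj n.+2 - sqrt_maj n.+1 =
      2^-1 * ((sqrt_maj n.+1 - sqrt_maj n) * (sqrt_maj n.+1 + sqrt_maj n)) :> R.
    by rewrite [sqrt_maj n.+2]sqrt_majS {2}[sqrt_maj n.+1]sqrt_majS !expr2; lra.
  rewrite nmZ ger0_norm// ler_wpM2l// (le_trans (nmM _ _))// ler_pM ?nm_ge0//.
  by rewrite (le_trans (nmD _ _))// lerD.
have y_tail n m : (n <= m)%N -> nm (y m - y n) <= sqrt_maj m - sqrt_maj n.
  move=> /subnKC <-; elim: (m - n)%N => [|k IHk]; first by rewrite addn0 !subrr nm0.
  rewrite addnS -(subrK (y (n + k)%N) (y _.+1)) -addrA.
  by rewrite (le_trans (nmD _ _))//; have := yS_le (n + k)%N; lra.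
have [b [b0 t_b]] := @sqrt_maj_null R.
have [l yl] : exists l, converges nm y l.
  apply: nm_complete b0 _ => n m nm; apply: le_trans (y_tail _ _ nm) (t_b _ _ nm).
have l_eq : l = 2^-1 *: (x + l ^+ 2).
  apply: (converges_unique nm_group_norm (converges_shift 1%N yl)).
  have -> : (fun n => y (n + 1)%N) = (fun n => 2^-1 *: (x + y n * y n)).
    by apply/funext => n; rewrite addn1 yS expr2.
  rewrite expr2; apply/convergesZ/(convergesD nm_group_norm); last exact: convergesM.
  exact: converges_cst nm_group_norm _.
have y_sa n : sa (y n).
  by elim: n => [|n IHn]; rewrite /sa ?linear0// yS; apply/saZ/saD/saX.
have sal : sa l.
  apply: (converges_unique nm_group_norm (converges_st yl)).
  by have -> : (fun n => st (y n)) = y by apply/funext => n; apply: y_sa.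
exists (1 - l); split.
- exact: saB sa1 sal.
- rewrite opprB addrC subrK -[l]subr0.
  apply: (converges_le nm_group_norm yl (cvg_cst 0)) => n.
  rewrite subr0 addr0 (le_trans (y_le n))//; by have /andP[] := @sqrt_maj_itv R n.
- have l2 : l + l = x + l ^+ 2.
    by rewrite {1 2}l_eq -scalerDl [_ + _](_ : _ = 1) ?scale1r//; lra.
  rewrite expr2 mulrBl mul1r mulrBr mulr1 -expr2.
  by rewrite -[x](addrK (l ^+ 2)) -l2; abel.
- move=> z zx; apply/commrB; first exact: commr1.
  by apply: (commutator_closed yl) => n; apply: y_comm.
Qed.

(** Positivity of a self-adjoint element without the spectrum: the spectrum lies
    in [0, 2t] exactly when a is within t of t. In this form sums of positive
    elements are visibly positive. *)
Definition pos a := sa a /\ exists2 t, 0 <= t & nm (t%:A - a) <= t.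

Lemma pos_sa a : pos a -> sa a. Proof. by case. Qed.

Lemma nm_shift a t : 0 <= t -> nm (t%:A - a) <= t -> nm a <= t + t.
Proof.
move=> t0 at_; rewrite -[a](subKr t%:A) (le_trans (nmB _ _))// lerD//.
by rewrite (le_trans (nm_scalar _))// ger0_norm.
Qed.

Lemma pos_sqrt a : pos a -> exists s,
  [/\ sa s, s ^+ 2 = a & forall z, GRing.comm z a -> GRing.comm z s].
Proof.
move=> [sa_a [t]]; rewrite le_eqVlt => /orP[/eqP<-|t0] at_.
  exists 0; split=> [||z _]; [exact: linear0| |exact: commr0].
  by rewrite expr0n/= [RHS](@nm_eq0 _ _ a)// (le_trans (nm_shift _ at_))// addr0.
have ti0 : 0 <= t^-1 by rewrite invr_ge0 ltW.
have [c [sac _ c2 c_comm]] : exists c,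
    [/\ sa c, nm (1 - c) <= 1, c ^+ 2 = 1 - t^-1 *: (t%:A - a)
    & forall z, GRing.comm z (t^-1 *: (t%:A - a)) -> GRing.comm z c].
  apply: sqrt_one_minus; first exact/saZ/saB/sa_a/sa_scalar.
  by rewrite nmZ ger0_norm// mulrC ler_pdivrMr// mul1r.
exists (Num.sqrt t *: c); split; first exact: saZ.
  rewrite expr2 -scaleAl -scaleAr scalerA -expr2 sqr_sqrtr ?ltW// -expr2 c2.
  by rewrite scalerBr scalerA mulfV ?gt_eqF// scale1r; abel.
move=> z za; apply/commZ/c_comm/commZ/commrB => //; exact: comm_scalar.
Qed.

Lemma st_ci_mul c : sa c -> st (ci * c) = - (ci * c).
Proof. by move=> sac; rewrite stM sac st_ci mulrN mul_ci. Qed.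

(** The element u = b + ic satisfies u^* u = 1, so that both u and u^* have norm
    at most one, and b is their mean. *)
Lemma nm_le1_of_sum_sqr b c : sa b -> sa c -> GRing.comm b c ->
  b ^+ 2 + c ^+ 2 = 1 -> nm b <= 1.
Proof.
move=> sab sac bc b2c2; pose u := b + ci * c.
have st_u : st u = b - ci * c by rewrite stD sab st_ci_mul.
have : nm (st u * u) <= 1.
  suff -> : st u * u = 1 by exact: nm1_le1.
  rewrite st_u mulrBl !mulrDr -b2c2 !expr2.
  rewrite -(mulrA ci c b) -bc (mulrA b ci c) mul_ci -(mulrA ci b c).
  rewrite -(mulrA ci c (ci * c)) (mulrA c ci c) mul_ci -(mulrA ci c c) (mulrA ci ci).
  by rewrite ci2 mulN1r; abel.
rewrite nmC expr_le1 ?nm_ge0// => u1.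
have -> : b = 2^-1 *: (u + st u).
  rewrite st_u /u [_ + _](_ : _ = b + b); last by abel.
  by rewrite scalerDr -scalerDl [X in X *: _](_ : _ = 1) ?scale1r//; lra.
rewrite nmZ ger0_norm ?invr_ge0// -ler_pdivlMl ?invr_gt0// invrK mulr1.
by rewrite (le_trans (nmD _ _))// nm_st; lra.
Qed.

(** With c a square root of 1 - b^2, the elements b and c satisfy b^2 + c^2 = 1,
    hence c, and with it c^2, has norm at most one. *)
Lemma nm_one_minus_sqr b : sa b -> nm b <= 1 -> nm (1 - b ^+ 2) <= 1.
Proof.
move=> sab b1.
have [c [sac _ c2 c_comm]] : exists c, [/\ sa c, nm (1 - c) <= 1,
    c ^+ 2 = 1 - b ^+ 2 & forall z, GRing.comm z (b ^+ 2) -> GRing.comm z c].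
  by apply: sqrt_one_minus; [exact: saX | rewrite nm_sqr// expr_le1// nm_ge0].
rewrite -c2 nm_sqr// expr_le1 ?nm_ge0//.
have bc : GRing.comm b c by apply/c_comm/commrX.
apply: (nm_le1_of_sum_sqr sac sab (commr_sym bc)).
by rewrite c2 subrK.
Qed.

Lemma nm_shift_sqr b t : sa b -> nm b ^+ 2 <= t -> nm (t%:A - b ^+ 2) <= t.
Proof.
move=> sab bt; have t0 : 0 <= t by rewrite (le_trans _ bt)// sqr_ge0.
case: (ltrgt0P t) t0 => // [t0 _|t0].
  pose r := Num.sqrt t; have r0 : 0 < r by rewrite sqrtr_gt0.
  have r2 : r ^+ 2 = t by rewrite sqr_sqrtr// ltW.
  have : nm (1 - (r^-1 *: b) ^+ 2) <= 1.
    apply: nm_one_minus_sqr; first exact: saZ.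
    rewrite nmZ ger0_norm ?invr_ge0 ?(ltW r0)// ler_pdivrMl// mulr1.
    by rewrite -(@ler_pXn2r _ 2)// ?nnegrE ?nm_ge0 ?(ltW r0)// r2.
  have -> : t%:A - b ^+ 2 = t *: (1 - (r^-1 *: b) ^+ 2).
    rewrite scalerBr !expr2 -scaleAl -scaleAr scalerA -r2; congr (_ - _).
    by rewrite scalerA expr2 -invfM mulfV ?scale1r// mulf_neq0// gt_eqF.
  by rewrite nmZ ger0_norm ?(ltW t0)// => ?; rewrite ler_piMr// ltW.
move=> _; have : nm b ^+ 2 <= 0 by rewrite -t0.
rewrite t0 => b0; have -> : b = 0.
  by apply: nm_eq0; rewrite -(@ler_pXn2r _ 2)// ?nnegrE ?nm_ge0// expr0n.
by rewrite scale0r expr0n subrr nm0.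
Qed.

Lemma pos_sqr b : sa b -> pos (b ^+ 2).
Proof.
move=> sab; split; first exact: saX.
by exists (nm b ^+ 2); rewrite ?sqr_ge0// nm_shift_sqr.
Qed.

(** The witness t in the definition of positivity may be any bound of the norm,
    since a positive element is a square. *)
Lemma pos_nm_shift a t : pos a -> nm a <= t -> nm (t%:A - a) <= t.
Proof.
by move=> /pos_sqrt[s [sas <- _]]; rewrite nm_sqr//; apply: nm_shift_sqr.
Qed.

Lemma posI a t : sa a -> nm (t%:A - a) <= t -> pos a.
Proof. by move=> sa_a at_; split=> //; exists t => //; apply: le_trans at_; apply: nm_ge0. Qed.

Lemma pos0 : pos 0.
Proof. by apply: (@posI _ 0); [exact: linear0|rewrite scale0r subr0 nm0]. Qed.

Lemma posD a b : pos a -> pos b -> pos (a + b).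
Proof.
move=> [sa_a [t t0 ta]] [sab [r r0 rb]]; apply: (@posI _ (t + r)); first exact: saD.
by rewrite scalerDl opprD addrACA (le_trans (nmD _ _))// lerD.
Qed.

Lemma posZ r a : 0 <= r -> pos a -> pos (r *: a).
Proof.
move=> r0 [sa_a [t t0 ta]]; apply: (@posI _ (r * t)); first exact: saZ.
by rewrite -scalerA -scalerBr nmZ ger0_norm// ler_wpM2l.
Qed.

Lemma pos_shift d t : sa d -> nm d <= t -> pos (t%:A + d).
Proof.
move=> sad dt; apply: (@posI _ t); first exact/saD/sad/sa_scalar.
by rewrite opprD addrA subrr add0r nmN.
Qed.

Lemma pos_shiftB d t : sa d -> nm d <= t -> pos (t%:A - d).
Proof. by move=> sad dt; apply: pos_shift; rewrite ?nmN//; apply: saN. Qed.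

Lemma pos_scalar t : 0 <= t -> pos t%:A.
Proof. by move=> t0; rewrite -[_%:A]addr0; apply: pos_shift; [exact: linear0|rewrite nm0]. Qed.

Lemma pos_eps a : sa a -> (forall e, 0 < e -> pos (e%:A + a)) -> pos a.
Proof.
move=> sa_a ae; apply: (@posI _ (nm a)) => //.
apply/ler_addgt0Pr => e e0.
have e2 : 0 < e / 2 by rewrite divr_gt0.
have := pos_nm_shift (ae _ e2) (nmD _ _).
set d := nm ((e / 2)%:A); set E := nm a => le1.
have d_le : d <= e / 2 by rewrite /d (le_trans (nm_scalar _))// ger0_norm// ltW.
have -> : E%:A - a = ((d + E)%:A - ((e / 2)%:A + a)) + (e / 2 - d)%:A.
  by rewrite !scalerDl scaleNr; abel.
rewrite (le_trans (nmD _ _))//.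
have := nm_scalar (e / 2 - d); rewrite ger0_norm; last by lra.
lra.
Qed.

Lemma pos_closed a : sa a ->
  (forall e, 0 < e -> exists2 b, pos b & nm (a - b) <= e) -> pos a.
Proof.
move=> sa_a ab; apply: pos_eps => // e /ab[b posb abe].
have -> : e%:A + a = (e%:A + (a - b)) + b by abel.
apply: posD => //; apply: pos_shift => //; apply: saB => //; exact: pos_sa.
Qed.

Lemma pos_converges u a : (forall n, pos (u n)) -> converges nm u a -> pos a.
Proof.
move=> posu ua; apply: pos_closed.
  apply: (converges_unique nm_group_norm (converges_st ua)).
  by rewrite (_ : (fun n => _) = u)//; apply/funext => n; apply: pos_sa.
move: ua; rewrite /converges nullP => [ua e /ua[N uN]|n]; last exact: nm_ge0.
by exists (u N) => //; rewrite (gnorm_distC nm_group_norm) uN.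
Qed.

Lemma pos_mul a b : pos a -> pos b -> GRing.comm a b -> pos (a * b).
Proof.
move=> /pos_sqrt[s [sas s2 s_comm]] /pos_sqrt[r [sar r2 r_comm]] ab.
have sr : GRing.comm s r.
  by apply/r_comm/commr_sym/s_comm/commr_sym.
by rewrite -s2 -r2 -exprMn_comm//; apply/pos_sqr/saM.
Qed.

Lemma pos_exp a n : pos a -> pos (a ^+ n).
Proof.
move=> posa; elim: n => [|n IHn]; first by rewrite expr0 -[1]scale1r; apply: pos_scalar.
by rewrite exprS; apply: pos_mul => //; apply: commrX.
Qed.

(** With s^2 = a and r^2 = t - a, the commuting elements s and r satisfy s^2 +
    r^2 = t. The upper bound is perturbed by a positive e so as to divide by it. *)
Lemma nm_le_pos a t : 0 <= t -> pos a -> pos (t%:A - a) -> nm a <= t.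
Proof.
move=> t0 posa posta; apply/ler_addgt0Pr => e e0; set T0 := t + e.
have T0_gt0 : 0 < T0 by rewrite /T0; lra.
have posb : pos (T0%:A - a).
  have -> : T0%:A - a = e%:A + (t%:A - a) by rewrite scalerDl; abel.
  by apply: posD => //; apply/pos_scalar/ltW.
have [s [sas s2 s_comm]] := pos_sqrt posa.
have [r [sar r2 r_comm]] := pos_sqrt posb.
have sr : GRing.comm s r.
  apply/r_comm/commrB; first exact: comm_scalar.
  by rewrite -s2; apply: commrX.
(* Rescaled to k s and k r, the two squares add up to 1. *)
pose k := (Num.sqrt T0)^-1.
have k2 : k * k = T0^-1 by rewrite /k -invfM -expr2 sqr_sqrtr// ltW.
have k0 : 0 <= k by rewrite invr_ge0 sqrtr_ge0.
have : nm (k *: s) <= 1.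
  apply: (@nm_le1_of_sum_sqr _ (k *: r)); [exact: saZ|exact: saZ| |].
    by apply/commZ/commr_sym/commZ/commr_sym.
  rewrite !expr2 -!scaleAl -!scaleAr !scalerA k2 -!expr2 s2 r2 -scalerDr.
  by rewrite addrC subrK scalerA mulVf ?scale1r// gt_eqF.
rewrite -(@expr_le1 _ 2)// ?nm_ge0// -nm_sqr; last exact: saZ.
rewrite expr2 -scaleAl -scaleAr scalerA k2 -expr2 s2 nmZ ger0_norm ?invr_ge0 ?(ltW T0_gt0)//.
by rewrite ler_pdivrMl// mulr1.
Qed.

(** The square of y is bounded by t^2, because t^2 - y^2 is the product of the
    commuting positive elements t - y and t + y. *)
Lemma nm_le_sym y t : 0 <= t -> sa y -> pos (t%:A - y) -> pos (t%:A + y) -> nm y <= t.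
Proof.
move=> t0 say pm pp; rewrite -(@ler_pXn2r _ 2)// ?nnegrE ?nm_ge0// -nm_sqr//.
apply: nm_le_pos; [exact: sqr_ge0|exact: pos_sqr|].
have ty : GRing.comm y t%:A by exact: comm_scalar.
have -> : (t ^+ 2)%:A - y ^+ 2 = (t%:A - y) * (t%:A + y).
  have tt : t%:A * t%:A = (t ^+ 2)%:A by rewrite -scaleAl mul1r scalerA.
  by rewrite mulrBl !mulrDr tt ty expr2; abel.
apply: pos_mul => //; apply: commr_sym; apply: commrB; first exact: comm_scalar.
by apply: commr_sym; apply: commrD.
Qed.

Lemma nm_mono a b : pos a -> pos (b - a) -> nm a <= nm b.
Proof.
move=> posa posba; apply: nm_le_pos => //; first exact: nm_ge0.
have posb : pos b by rewrite -[b](subrK a); apply: posD.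
have -> : (nm b)%:A - a = ((nm b)%:A - b) + (b - a) by abel.
by apply: posD => //; apply: pos_shiftB => //; apply: pos_sa.
Qed.

Lemma nm_exp b k : sa b -> nm (b ^+ k.+1) = nm b ^+ k.+1.
Proof.
move=> sab; move: k.+1 (ltn0Sn k) => n n_gt0; apply/eqP; rewrite eq_le nmX/=.
have pow2 j : nm (b ^+ (2 ^ j)) = nm b ^+ (2 ^ j).
  elim: j => [|j IHj]; first by rewrite expn0 !expr1.
  by rewrite expnS mulnC !exprM nm_sqr ?IHj//; apply: saX.
have [b0|b_gt0] := leP (nm b) 0.
  have -> : nm b = 0 by apply/le_anti; rewrite b0 nm_ge0.
  by rewrite expr0n gtn_eqF// nm_ge0.
have n2 : (n <= 2 ^ n)%N by rewrite ltnW// ltn_expl.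
have := pow2 n; rewrite -{1}(subnK n2) exprD => e.
have := nmM (b ^+ (2 ^ n - n)) (b ^+ n).
rewrite e -{1}(subnK n2) exprD => h.
have := le_trans h (ler_wpM2r (nm_ge0 _) (nmX _ _)).
by rewrite ler_pM2l// exprn_gt0.
Qed.

(** Applied to norms of powers of self-adjoint elements, this replaces the
    spectral radius formula. *)
Lemma exp_bounded_le1 (v d C : R) : 0 < d -> (forall n, v ^+ n * d <= C) -> v <= 1.
Proof.
move=> d0 vC; rewrite leNgt; apply/negP => v1.
pose w := v - 1; have w0 : 0 < w by rewrite subr_gt0.
have bern n : 1 + n%:R * w <= v ^+ n.
  elim: n => [|n IHn]; first by rewrite mul0r addr0 expr0.
  rewrite exprS -natr1; have -> : v = 1 + w by rewrite addrC subrK.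
  move: IHn; have -> : v = 1 + w by rewrite addrC subrK.
  set X := _ ^+ n => IHn; have : 0 <= n%:R * w :> R by rewrite mulr_ge0// ltW.
  nra.
have C0 : 0 <= C by rewrite (le_trans _ (vC 0%N))// expr0 mul1r ltW.
have wd : 0 < w * d by rewrite mulr_gt0.
have := archi_boundP (divr_ge0 C0 (ltW wd)); set n := Num.bound _.
rewrite ltr_pdivrMr// => lt_C.
have := vC n; have := bern n; nra.
Qed.

(** In terms of spectra, z z^* and z^* z have the same nonzero spectrum, so that
    a lower bound for one is a lower bound for the other. Here this is replaced
    by intertwining: with w = z z^*, y = z^* z, c = |z|^2, p = c - w and q = c -
    y, one has q^n z^* = z^* p^n, so that the norm of q^n y is at most c (c +
    1)^n, whereas it would grow like |q|^n if the norm of q exceeded c + 1. *)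
Lemma pos_shift_swap z : pos (1 + z * st z) -> pos (1 + st z * z).
Proof.
set w := z * st z; set y := st z * z => posw.
have saw : sa w by rewrite /sa stM stK.
have say : sa y by rewrite /sa stM stK.
pose c := nm z ^+ 2; have c0 : 0 <= c by apply: sqr_ge0.
have c1 : 0 < c + 1 by lra.
have wc : nm w <= c by rewrite (le_trans (nmM _ _))// nm_st -expr2.
have yc : nm y <= c by rewrite /y nmC.
pose p := c%:A - w; pose q := c%:A - y.
have sap : sa p by apply: saB => //; apply: sa_scalar.
have saq : sa q by apply: saB => //; apply: sa_scalar.
have p_le : nm p <= c + 1.
  apply: nm_le_sym => //; first exact: ltW.
  - have -> : (c + 1)%:A - p = 1 + w by rewrite scalerDl scale1r /p; abel.
    exact: posw.
  - by rewrite addrC; apply/posD/pos_scalar/ltW => //; apply: pos_shiftB.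
have qz n : q ^+ n * st z = st z * p ^+ n.
  elim: n => [|n IHn]; first by rewrite !expr0 mul1r mulr1.
  rewrite exprS -mulrA IHn mulrA exprS [RHS]mulrA; congr (_ * _).
  by rewrite mulrBl mulrBr -scaleAl -scaleAr mul1r mulr1 /y /w mulrA.
have q_le : nm q <= c + 1.
  rewrite leNgt; apply/negP => q_gt.
  have q0 : 0 < nm q by rewrite (lt_trans _ q_gt).
  suff : nm q / (c + 1) <= 1 by rewrite ler_pdivrMr// mul1r leNgt q_gt.
  apply: (@exp_bounded_le1 _ (nm q * (nm q - c)) (c * (c + 1))).
    by rewrite mulr_gt0// subr_gt0; lra.
  move=> n; rewrite expr_div_n mulrAC ler_pdivrMr ?exprn_gt0//.
  have -> : nm q ^+ n * (nm q * (nm q - c)) = nm q ^+ n.+2 - c * nm q ^+ n.+1.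
    by rewrite !exprS; lra.
  have : nm (q ^+ n.+1 * y) <= c * (c + 1) ^+ n.+1.
    rewrite mulrA qz -mulrA (le_trans (nmM _ _))// nm_st.
    rewrite (le_trans (ler_wpM2l (nm_ge0 _) (nmM _ _)))// mulrCA mulrC /c -expr2.
    rewrite ler_wpM2l ?sqr_ge0// (le_trans (nmX _ _))// lerXn2r// nnegrE ?nm_ge0//.
    exact: ltW.
  have -> : q ^+ n.+1 * y = c *: q ^+ n.+1 - q ^+ n.+2.
    by rewrite [q ^+ n.+2]exprSr {3}/q mulrBr -scaleAr mulr1; abel.
  move=> le1; rewrite -!nm_exp// -[c * (c + 1) * _]mulrA -exprS.
  apply: le_trans le1; rewrite lerBlDl -{1}[q ^+ n.+2](subKr (c *: q ^+ n.+1)).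
  by rewrite (le_trans (nmB _ _))// nmZ ger0_norm.
have -> : 1 + y = (c + 1)%:A - q by rewrite scalerDl scale1r /q; abel.
exact: pos_shiftB.
Qed.

(** In terms of the real and imaginary parts, z^* z + z z^* is a sum of two
    squares. *)
Lemma pos_star_sum z : pos (st z * z + z * st z).
Proof.
pose h := z + st z; pose k := ci * (z - st z).
have sah : sa h by rewrite /sa stD stK addrC.
have sak : sa k.
  by rewrite /sa stM st_ci linearB/= stK mulrN mul_ci -mulrN opprB.
have h2 : h ^+ 2 = z * z + z * st z + (st z * z + st z * st z).
  by rewrite expr2 mulrDl !mulrDr.
have k2 : k ^+ 2 = - (z * z - z * st z - (st z * z - st z * st z)).
  rewrite expr2 /k mulrA -(mulrA ci _ ci) mul_ci mulrA -mulrA ci2 mulN1r.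
  by rewrite mulrBl !mulrBr.
have -> : st z * z + z * st z = 2^-1 *: (h ^+ 2 + k ^+ 2).
  rewrite h2 k2 [X in 2^-1 *: X](_ : _ = (st z * z + z * st z) + (st z * z + z * st z)).
    by rewrite scalerDr -scalerDl [X in X *: _](_ : _ = 1) ?scale1r//; lra.
  abel.
by apply/posZ/posD; rewrite ?invr_ge0//; apply: pos_sqr.
Qed.

(** Let a = x^* x have norm at most one and put b = 1 - a. If b had norm larger
    than 1, then the elements z = x b^n would have z^* z = a b^(2n) = b^(2n) -
    b^(2n+1) of unbounded norm. But 1 - z^* z = b + (1 - b)^2 (1 + b + ... +
    b^(2n-1)) is positive, so 1 + z z^* is positive as well, since z^* z + z z^*
    is; moving the lower bound from z z^* to z^* z shows that z^* z has norm at
    most one. *)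
Lemma pos_star_mul x : pos (st x * x).
Proof.
wlog x1 : x / nm x <= 1 => [pos1|].
  have [x1|x1] := leP (nm x) 1; first exact: pos1.
  have x0 : 0 < nm x by rewrite (lt_trans _ x1).
  have -> : st x * x = nm x ^+ 2 *: (st ((nm x)^-1 *: x) * ((nm x)^-1 *: x)).
    rewrite stZ -scaleAl -scaleAr !scalerA -mulrA -invfM -expr2.
    by rewrite mulfV ?scale1r// expf_neq0// gt_eqF.
  apply/posZ/pos1; first exact: sqr_ge0.
  by rewrite nmZ ger0_norm ?invr_ge0 ?(ltW x0)// mulVf ?gt_eqF.
pose a := st x * x; pose b := 1 - a.
have saa : sa a by rewrite /sa stM stK.
have sab : sa b by apply: saB => //; exact: sa1.
have na : nm a <= 1 by rewrite nmC expr_le1 ?nm_ge0.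
have posb : pos b by rewrite /b -[1]scale1r; apply: pos_shiftB.
have ab : a = 1 - b by rewrite /b; abel.
(* A certificate that a b^m <= 1, as b is positive. *)
have tel m : 1 - a * b ^+ m = b + (1 - b) ^+ 2 * \sum_(i < m) b ^+ i.
  elim: m => [|m IHm]; first by rewrite big_ord0 mulr0 addr0 expr0 mulr1.
  rewrite big_ord_recr/= mulrDr addrA -IHm ab exprS.
  have -> : (1 - b) ^+ 2 * b ^+ m = (1 - b) * b ^+ m - (1 - b) * (b * b ^+ m).
    by rewrite expr2 -mulrA -mulrBr [(1 - b) * b ^+ m]mulrBl mul1r.
  by abel.
have pos1 m : pos (1 - a * b ^+ m).
  rewrite tel; apply: posD => //; apply: pos_mul.
  - by apply/pos_sqr/saB => //; exact: sa1.
  - elim/big_rec: _ => [|i y _ posy]; first exact: pos0.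
    by apply: posD => //; apply: pos_exp.
  - apply: commr_sum => i _; apply: commrX; apply: commr_sym; apply: commrX.
    by apply: commrB => //; apply: commr1.
have y_le1 n : nm (a * b ^+ n.*2) <= 1.
  pose z := x * b ^+ n.
  have ba : GRing.comm (b ^+ n) a.
    by apply: commr_sym; apply: commrX; rewrite /b; apply: commrB; [apply: commr1|].
  have zz : st z * z = a * b ^+ n.*2.
    rewrite /z stM (saX n sab) -addnn exprD mulrA -(mulrA _ (st x)) -/a.
    by rewrite ba -!mulrA.
  have say : sa (a * b ^+ n.*2) by rewrite /sa -zz stM stK.
  apply: nm_le_sym => //; rewrite scale1r; first exact: pos1.
  rewrite -zz; apply: pos_shift_swap.
  have -> : 1 + z * st z = (st z * z + z * st z) + (1 - st z * z) by abel.
  by apply: posD; [exact: pos_star_sum|rewrite zz; exact: pos1].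
apply: (@posI _ 1); first exact: saa.
rewrite scale1r -/a -/b leNgt; apply/negP => b1.
have b0 : 0 < nm b by rewrite (lt_trans _ b1).
have : nm b ^+ 2 <= 1.
  apply: (@exp_bounded_le1 _ (nm b ^+ 2 * (nm b - 1)) 1).
    by rewrite mulr_gt0 ?exprn_gt0// subr_gt0.
  move=> n; rewrite -exprM mulrA -exprD mulrBr mulr1 -exprSr.
  have := y_le1 n.+1; rewrite ab mulrBl mul1r -exprS doubleS => le1.
  rewrite addn2 mul2n -!nm_exp// lerBlDr.
  rewrite -[X in nm X <= _](subrK (b ^+ n.*2.+2)).
  apply: le_trans (nmD _ _) _; rewrite lerD2r (gnorm_distC nm_group_norm).
  exact: le1.
by rewrite expr_le1 ?nm_ge0// leNgt b1.
Qed.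

Lemma pos_conj a c : pos a -> pos (st c * a * c).
Proof.
move=> /pos_sqrt[s [sas <- _]].
have -> : st c * s ^+ 2 * c = st (s * c) * (s * c).
  by rewrite stM sas expr2 !mulrA.
exact: pos_star_mul.
Qed.

End Positivity.

(** * Inner products and Hilbert modules *)

Section SemiInnerProduct.
Context {R : realType} {A : cstarAlgType R} {V : zmodType}.
Local Notation T := (calg A).
Local Notation "r %:A" := (r *: (1 : T)) : ring_scope.
Variables (act : V -> T -> V) (ip : V -> V -> T).

(** Definiteness is left out so that the theory also applies to the partial sums
    of the inner product of sequences. *)
Definition semi_inner_product :=
  [/\ forall x y z, ip x (y + z) = ip x y + ip x z,
      forall x y a, ip x (act y a) = ip x y * a,
      forall x y, st (ip x y) = ip y x & forall x, pos (ip x x)].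

Definition semi_norm (x : V) : R := Num.sqrt (nm (ip x x)).

Hypothesis ipP : semi_inner_product.

Lemma sipDr x y z : ip x (y + z) = ip x y + ip x z. Proof. by case: ipP. Qed.
Lemma sipZr x y a : ip x (act y a) = ip x y * a. Proof. by case: ipP. Qed.
Lemma sip_st x y : st (ip x y) = ip y x. Proof. by case: ipP. Qed.
Lemma sip_pos x : pos (ip x x). Proof. by case: ipP. Qed.

Lemma sipDl x y z : ip (x + y) z = ip x z + ip y z.
Proof. by rewrite -sip_st sipDr stD !sip_st. Qed.
Lemma sipZl x y a : ip (act x a) y = st a * ip x y.
Proof. by rewrite -sip_st sipZr stM sip_st. Qed.
Lemma sip0r x : ip x 0 = 0.
Proof. by apply: (addrI (ip x 0)); rewrite -sipDr !addr0. Qed.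
Lemma sipNr x y : ip x (- y) = - ip x y.
Proof. by apply/eqP; rewrite -addr_eq0 -sipDr addNr sip0r. Qed.
Lemma sipNl x y : ip (- x) y = - ip x y.
Proof. by rewrite -sip_st sipNr linearN/= sip_st. Qed.

Lemma semi_norm_ge0 x : 0 <= semi_norm x. Proof. exact: sqrtr_ge0. Qed.

Lemma semi_norm_sqr x : semi_norm x ^+ 2 = nm (ip x x).
Proof. by rewrite sqr_sqrtr// nm_ge0. Qed.

(** Expanding <v, v> >= 0 for v = y - x <x, y> / t, with t at least the norm of
    <x, x>, gives <x, y>^* <x, y> <= t <y, y> in the order of the algebra; then
    let t decrease to that norm. *)
Lemma cauchy_schwarz x y : nm (ip x y) <= semi_norm x * semi_norm y.
Proof.
rewrite -(@ler_pXn2r _ 2)// ?nnegrE ?nm_ge0 ?mulr_ge0 ?semi_norm_ge0//.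
rewrite exprMn !semi_norm_sqr.
suff le_t t : 0 < t -> nm (ip x x) <= t -> nm (ip x y) ^+ 2 <= t * nm (ip y y).
  apply/ler_addgt0Pr => e e0; set Y := nm (ip y y).
  have Y0 : 0 <= Y by exact: nm_ge0.
  pose d := e / (Y + 1); have d0 : 0 < d by rewrite divr_gt0// ltr_wpDl.
  have X0 := nm_ge0 (ip x x).
  have := le_t (nm (ip x x) + d); rewrite ltr_wpDl// lerDl ltW// => /(_ isT isT).
  move=> /le_trans; apply; rewrite mulrDl lerD2l -/Y /d mulrAC ler_pdivrMr ?ltr_wpDl//.
  by rewrite ler_wpM2l ?(ltW e0)// lerDl.
move=> t0 Xt; set s := ip x y; pose v := y - act x (t^-1 *: s).
have posX : pos (st s * (t%:A - ip x x) * s).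
  by apply/pos_conj/pos_shiftB => //; apply/pos_sa/sip_pos.
have v_eq : ip y y - t^-1 *: (st s * s) =
    ip v v + (t^-1 * t^-1) *: (st s * (t%:A - ip x x) * s).
  have -> : st s * (t%:A - ip x x) * s = t *: (st s * s) - st s * ip x x * s.
    by rewrite mulrBr mulrBl -scaleAr mulr1 -scaleAl.
  have -> : ip v v = ip y y - t^-1 *: (st s * s) - t^-1 *: (st s * s)
      + (t^-1 * t^-1) *: (st s * ip x x * s).
    rewrite /v !(sipDr, sipDl, sipNr, sipNl, sipZr, sipZl) -/s -(sip_st x y) -/s.
    by rewrite stZ -!(scaleAl, scaleAr) scalerA; abel.
  rewrite scalerBr scalerA -[t^-1 * t^-1 * t]mulrA mulVf ?gt_eqF// mulr1; abel.
have le_tY : nm (t^-1 *: (st s * s)) <= nm (ip y y).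
  apply: nm_mono; first by apply/posZ/pos_star_mul; rewrite invr_ge0 ltW.
  rewrite v_eq; apply/posD; first exact: sip_pos.
  by apply: posZ => //; rewrite mulr_ge0// invr_ge0 ltW.
by move: le_tY; rewrite nmZ ger0_norm ?invr_ge0 ?(ltW t0)// nmC ler_pdivrMl.
Qed.

Lemma semi_normD x y : semi_norm (x + y) <= semi_norm x + semi_norm y.
Proof.
have := semi_norm_ge0 x; have := semi_norm_ge0 y => y0 x0.
rewrite -(@ler_pXn2r _ 2)// ?nnegrE ?semi_norm_ge0 ?addr_ge0// semi_norm_sqr.
rewrite sipDr !sipDl (le_trans (nmD _ _))//.
have := nmD (ip x x) (ip y x); have := nmD (ip x y) (ip y y).
have := cauchy_schwarz x y; have := cauchy_schwarz y x.
have := semi_norm_sqr x; have := semi_norm_sqr y.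
by rewrite !expr2; lra.
Qed.

Lemma semi_normN x : semi_norm (- x) = semi_norm x.
Proof. by rewrite /semi_norm sipNr sipNl opprK. Qed.

Lemma semi_norm_act x a : semi_norm (act x a) <= semi_norm x * nm a.
Proof.
rewrite -(@ler_pXn2r _ 2)// ?nnegrE ?mulr_ge0 ?semi_norm_ge0 ?nm_ge0//.
rewrite exprMn !semi_norm_sqr sipZr sipZl (le_trans (nmM _ _))// expr2 mulrA.
by rewrite ler_wpM2r ?nm_ge0// (le_trans (nmM _ _))// nm_st mulrC.
Qed.

End SemiInnerProduct.

Section HilbertModule.
Context {R : realType}.

Structure hilbertModule (A : cstarAlgType R) := HilbertModule {
  hm_sort :> zmodType ;
  mact : hm_sort -> calg A -> hm_sort ;
  ip : hm_sort -> hm_sort -> calg A ;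
  mactDl : forall x y a, mact (x + y) a = mact x a + mact y a ;
  mactDr : forall x a b, mact x (a + b) = mact x a + mact x b ;
  mactA : forall x a b, mact (mact x a) b = mact x (a * b) ;
  mact1 : forall x, mact x 1 = x ;
  ipP : semi_inner_product mact ip ;
  ip_definite : forall x, ip x x = 0 -> x = 0 ;
  hm_complete : norm_complete (semi_norm ip)
}.

Context {A : cstarAlgType R} {H : hilbertModule A}.
Local Notation T := (calg A).
Local Notation "r %:A" := (r *: (1 : T)) : ring_scope.
Implicit Types (x y z : H) (a b : T) (r : R).

Definition hn x : R := semi_norm (@ip A H) x.

Lemma ipDr x y z : ip x (y + z) = ip x y + ip x z. Proof. exact: (sipDr (ipP H)). Qed.
Lemma ipDl x y z : ip (x + y) z = ip x z + ip y z. Proof. exact: (sipDl (ipP H)). Qed.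
Lemma ipZr x y a : ip x (mact y a) = ip x y * a. Proof. exact: (sipZr (ipP H)). Qed.
Lemma ipZl x y a : ip (mact x a) y = st a * ip x y. Proof. exact: (sipZl (ipP H)). Qed.
Lemma ip_st x y : st (ip x y) = ip y x. Proof. exact: (sip_st (ipP H)). Qed.
Lemma ip_pos x : pos (ip x x). Proof. exact: (sip_pos (ipP H)). Qed.
Lemma ipNr x y : ip x (- y) = - ip x y. Proof. exact: (sipNr (ipP H)). Qed.
Lemma ipNl x y : ip (- x) y = - ip x y. Proof. exact: (sipNl (ipP H)). Qed.
Lemma ipBr x y z : ip x (y - z) = ip x y - ip x z. Proof. by rewrite ipDr ipNr. Qed.
Lemma ipBl x y z : ip (x - y) z = ip x z - ip y z. Proof. by rewrite ipDl ipNl. Qed.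
Lemma ip0r x : ip x 0 = 0. Proof. exact: (sip0r (ipP H)). Qed.
Lemma ip0l x : ip 0 x = 0. Proof. by rewrite -ip_st ip0r linear0. Qed.

Lemma ip_ext x y : (forall z, ip z x = ip z y) -> x = y.
Proof.
by move=> xy; apply/subr0_eq/ip_definite; rewrite ipBr xy subrr.
Qed.

Lemma hn_sqr x : hn x ^+ 2 = nm (ip x x). Proof. exact: semi_norm_sqr. Qed.

Lemma hn_ge0 x : 0 <= hn x. Proof. exact: semi_norm_ge0. Qed.

Lemma hn_norm : group_norm hn.
Proof.
split.
- by rewrite /hn/semi_norm ip0r nm0 sqrtr0.
- exact: (semi_normN (ipP H)).
- exact: (semi_normD (ipP H)).
- move=> x x0; apply/ip_definite/nm_eq0.
  by rewrite -hn_sqr x0 expr0n.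
Qed.

Lemma hn0 : hn (0 : H) = 0. Proof. by case: (@hn_norm). Qed.
Lemma hnN x : hn (- x) = hn x. Proof. exact: gnormN hn_norm x. Qed.
Lemma hnD x y : hn (x + y) <= hn x + hn y. Proof. exact: gnormD hn_norm x y. Qed.
Lemma hnB x y : hn (x - y) <= hn x + hn y. Proof. exact: gnormB hn_norm x y. Qed.
Lemma hn_eq0 x : hn x <= 0 -> x = 0. Proof. exact: (gnorm_eq0 hn_norm). Qed.

Lemma ip_le x y : nm (ip x y) <= hn x * hn y. Proof. exact: (cauchy_schwarz (ipP H)). Qed.

Lemma hn_act x a : hn (mact x a) <= hn x * nm a. Proof. exact: (semi_norm_act (ipP H)). Qed.

Lemma hn_scale r x : hn (mact x r%:A) = `|r| * hn x.
Proof.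
rewrite /hn/semi_norm ipZr ipZl stZ st1 -scaleAl -scaleAr mul1r mulr1 scalerA nmZ.
by rewrite sqrtrM// -expr2 normrX sqrtr_sqr normr_id.
Qed.

Lemma mact0 a : mact (0 : H) a = 0.
Proof. by apply: (addrI (mact 0 a)); rewrite -mactDl !addr0. Qed.

Lemma mactN x a : mact (- x) a = - mact x a.
Proof. by apply/eqP; rewrite -addr_eq0 -mactDl addNr mact0. Qed.

Lemma mactB x y a : mact (x - y) a = mact x a - mact y a.
Proof. by rewrite mactDl mactN. Qed.

Lemma hn_le_sqr x c : 0 <= c -> nm (ip x x) <= c ^+ 2 -> hn x <= c.
Proof.
by move=> c0; rewrite -hn_sqr ler_pXn2r// nnegrE// hn_ge0.
Qed.

End HilbertModule.

(** * A Baire category argument for gauges *)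

Section Gauge.
Context {R : realType} {A : cstarAlgType R} {H : hilbertModule A}.
Implicit Types (x y z : H) (r t e : R).

Definition hscale r x : H := mact x (r *: (1 : calg A)).

Lemma hscale1 x : hscale 1 x = x. Proof. by rewrite /hscale scale1r mact1. Qed.
Lemma hscaleA r t x : hscale r (hscale t x) = hscale (r * t) x.
Proof. by rewrite /hscale mactA -scaleAl mul1r scalerA mulrC. Qed.
Lemma hscaleB r x y : hscale r (x - y) = hscale r x - hscale r y.
Proof. exact: mactB. Qed.
Lemma hn_hscale r x : hn (hscale r x) = `|r| * hn x.
Proof. exact: hn_scale. Qed.

(** The form of closedness in the definition of closed submodules, with real e. *)
Definition hlim_closed (E : H -> Prop) :=
  forall l, (forall e, 0 < e -> exists2 y, E y & hn (l - y) < e) -> E l.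

Lemma hlim_closed_converges (E : H -> Prop) u l :
  hlim_closed E -> (forall n, E (u n)) -> converges hn u l -> E l.
Proof.
move=> closedE Eu; rewrite /converges nullP => [ul|n]; last exact: hn_ge0.
apply: closedE => e e0; have [|N uN] := ul (e / 2); first by rewrite divr_gt0.
by exists (u N) => //; rewrite (gnorm_distC hn_norm) (le_lt_trans (uN _ _))//; lra.
Qed.

Lemma half_geometric_null c : null (fun n => c / 2 ^+ n : R).
Proof.
have -> : (fun n => c / 2 ^+ n : R) = (fun n => c * 2^-1 ^+ n).
  by apply/funext => n; rewrite exprVn.
by apply: null_geometric; lra.
Qed.

(** Approximating sequences with a geometric rate are Cauchy with an explicit
    modulus. *)
Lemma hlim_closed_geometric (E : H -> Prop) :
  (forall u l, (forall n, E (u n)) -> (forall n, hn (u n - l) <= 1 / 2 ^+ n) -> E l) ->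
  hlim_closed E.
Proof.
move=> EP l El.
have [u uP] : {u & forall n, E (u n) /\ hn (u n - l) <= 1 / 2 ^+ n}.
  apply: (choice (P := fun n x => E x /\ hn (x - l) <= 1 / 2 ^+ n)) => n.
  have [|y Ey ly] := El (1 / 2 ^+ n); first by rewrite divr_gt0// exprn_gt0.
  by exists y; rewrite (gnorm_distC hn_norm) ltW.
by apply: (EP u) => n; have [] := uP n.
Qed.

Variables (E : H -> Prop) (B : R -> H -> Prop).
Hypothesis E_sub : forall x y, E x -> E y -> E (x - y).
Hypothesis E_scale : forall r x, E x -> E (hscale r x).
Hypothesis E_lim : hlim_closed E.
Hypothesis B_E : forall r x, B r x -> E x.
Hypothesis B_mono : forall r t x, r <= t -> B r x -> B t x.
Hypothesis B_sub : forall r t x y, B r x -> B t y -> B (r + t) (x - y).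
Hypothesis B_scale : forall c r x, 0 <= c -> B r x -> B (c * r) (hscale c x).
Hypothesis B_cover : forall x, E x -> exists r, B r x.
Hypothesis B_series : forall r b y, 0 <= r -> (forall j, B (r / 2 ^+ j) (b j)) ->
  converges hn (fun n => \sum_(i < n) b i) y -> B (r + r) y.

(** Read B r y as: y has size at most r. If no set of elements of size at most k
    were dense in a ball, one could choose nested balls that avoid these sets
    one after the other; their common point would have no size. *)
Lemma gauge_somewhere_dense : (exists x, E x) -> exists k y0 e, [/\ E y0, 0 < e &
  forall y, E y -> hn (y - y0) <= e -> forall d, 0 < d -> exists2 b, B k%:R b & hn (y - b) < d].
Proof.
move=> [x0 Ex0]; apply: contrapT => nodense.
pose good (s : nat * (H * R)) (s' : H * R) := E s.2.1 -> 0 < s.2.2 ->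
  [/\ E s'.1, hn (s'.1 - s.2.1) <= s.2.2 / 2, 0 < s'.2, s'.2 <= s.2.2 / 2
    & forall b, B s.1%:R b -> s'.2 < hn (s'.1 - b)].
have [step stepP] : {f & forall s, good s (f s)}.
  apply: (choice (P := good)) => -[k [y0 e]].
  have [[Ey0 e0]|nE] := pselect (E y0 /\ 0 < e); last first.
    by exists (y0, e) => Ey0 e0; case: nE.
  apply: contrapT => noy; apply: nodense; exists k, y0, (e / 2).
  split=> //; first by rewrite divr_gt0.
  move=> y Ey yy0 d d0; apply: contrapT => nob; apply: noy.
  exists (y, Num.min (d / 2) (e / 2)) => _ _ /=; split=> //.
  - by rewrite lt_min !divr_gt0.
  - by rewrite ge_min lexx orbT.
  - move=> b Bb; rewrite ltNge; apply/negP => le_b; apply: nob; exists b => //.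
    by apply: (le_lt_trans le_b); rewrite gt_min; apply/orP; left; lra.
pose s := fix s n : H * R := if n is m.+1 then step (m, s m) else (x0, 1).
have sP n : E (s n).1 /\ 0 < (s n).2.
  by elim: n => [|n [En en]] //=; case: (stepP (n, s n) En en).
have sS n : [/\ hn ((s n.+1).1 - (s n).1) <= (s n).2 / 2, (s n.+1).2 <= (s n).2 / 2
    & forall b, B n%:R b -> (s n.+1).2 < hn ((s n.+1).1 - b)].
  by have [En en] := sP n; case: (stepP (n, s n) En en).
have e_le n : (s n).2 <= 1 / 2 ^+ n.
  elim: n => [|n IHn]; first by rewrite expr0 divr1.
  by have [_ le2 _] := sS n; rewrite exprS invfM; lra.
have e_null : null (fun n => (s n).2).
  apply: null_squeeze (half_geometric_null 1) _ => n.
  by rewrite e_le ltW//; case: (sP n).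
have tail n m : (n <= m)%N -> hn ((s m).1 - (s n).1) <= (s n).2.
  move=> /subnKC <-; apply: (@le_trans _ _ ((s n).2 - (s (n + (m - n))%N).2)).
    elim: (m - n)%N => [|k IHk]; first by rewrite addn0 !subrr hn0.
    rewrite addnS; apply: le_trans (gnorm_triangle hn_norm (s (n + k)%N).1 _ _) _.
    by have [le1 le2 _] := sS (n + k)%N; lra.
  by rewrite gerBl ltW//; case: (sP (n + (m - n))%N).
have [l sl] := hm_complete e_null tail.
have El : E l.
  by apply: (hlim_closed_converges E_lim _ sl) => n; case: (sP n).
have [r Br] := B_cover El.
have [k rk] : exists k : nat, r <= k%:R.
  by exists (Num.bound `|r|); apply: le_trans (ler_norm r) (ltW (archi_boundP (normr_ge0 r))).
have [_ _ /(_ l (B_mono rk Br))] := sS k.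
apply/negP; rewrite -leNgt (gnorm_distC hn_norm).
exact: (converges_tail_le hn_norm sl (tail k.+1)).
Qed.

(** An abstract open mapping theorem. By density in a ball and homogeneity,
    every y is approximated within half its norm by an element of size at most c
    |y|; iterating on the remainders expresses y as a series of elements whose
    sizes decrease geometrically. A gauge is used instead of a map so that the
    same statement covers both surjections and direct sums. *)
Lemma gauge_bounded : exists2 C, 0 <= C & forall y, E y -> B (C * hn y) y.
Proof.
have [/gauge_somewhere_dense[k [y0 [e [Ey0 e0 dense]]]]|noE] := pselect (exists x, E x); last first.
  by exists 0 => // y Ey; case: noE; exists y.
pose c := (k%:R + k%:R) / e : R; have c0 : 0 <= c by rewrite divr_ge0 ?addr_ge0 ?(ltW e0).
have E0 : E 0 by rewrite -(subrr y0); apply: E_sub.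
have approx y d : E y -> 0 < d -> exists2 b, B (c * hn y) b & hn (y - b) <= d * hn y.
  move=> Ey d0; have [/hn_eq0 ->|y_gt0] := leP (hn y) 0.
    have [r Br] := B_cover E0.
    exists 0; rewrite ?subr0 hn0 ?mulr0//.
    have := B_scale (lexx 0) Br; rewrite mul0r.
    by rewrite (_ : hscale 0 0 = 0)//; apply: hn_eq0; rewrite hn_hscale normr0 mul0r.
  (* The element t y has norm e; differences of approximants of y0 + t y and
     of y0 approximate t y. *)
  pose t := e / hn y; have t0 : 0 < t by rewrite divr_gt0.
  pose d' := d * e / 2; have d'0 : 0 < d' by rewrite divr_gt0 ?mulr_gt0.
  have near z : E z -> hn z <= e -> exists2 b, B k%:R b & hn (y0 + z - b) < d'.
    move=> Ez ze; apply: dense => //; last by rewrite [y0 + z]addrC addrK.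
    by rewrite -[z]opprK -[- z]sub0r; apply/E_sub/E_sub.
  have [b1 Bb1 le1] : exists2 b, B k%:R b & hn (y0 + hscale t y - b) < d'.
    apply: near; first exact: E_scale.
    by rewrite hn_hscale gtr0_norm// divfK ?gt_eqF.
  have [b2 Bb2 le2] : exists2 b, B k%:R b & hn (y0 + 0 - b) < d'.
    by apply: near => //; rewrite hn0 ltW.
  exists (hscale t^-1 (b1 - b2)).
    have -> : c * hn y = t^-1 * (k%:R + k%:R).
      by rewrite /c /t invf_div [LHS]mulrC mulrA [RHS]mulrAC.
    by apply: B_scale; [rewrite invr_ge0 ltW|exact: B_sub].
  have -> : y - hscale t^-1 (b1 - b2) =
      hscale t^-1 ((y0 + hscale t y - b1) - (y0 + 0 - b2)).
    rewrite -[X in X - _]hscale1 -(mulVf (lt0r_neq0 t0)) -hscaleA -hscaleB.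
    by congr hscale; abel.
  rewrite hn_hscale ger0_norm ?invr_ge0 ?(ltW t0)// ler_pdivrMl//.
  rewrite (le_trans (hnB _ _))// /t mulrCA divfK ?gt_eqF//.
  by move: le1 le2; rewrite /d'; lra.
exists (c + c) => [|y Ey]; first exact: addr_ge0.
pose P z b := E z -> B (c * hn z) b /\ hn (z - b) <= 2^-1 * hn z.
have [f fP] : {f & forall z, P z (f z)}.
  apply: (choice (P := P)) => z; have [Ez|nEz] := pselect (E z); last by exists z.
  by have [b Bb zb] := approx z 2^-1 Ez ltac:(lra); exists b.
pose v := fix v n := if n is m.+1 then v m - f (v m) else y.
have Ev n : E (v n).
  by elim: n => // n Evn; apply: E_sub => //; have [/B_E] := fP _ Evn.
have v_le n : hn (v n) <= hn y / 2 ^+ n.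
  elim: n => [|n IHn]; first by rewrite expr0 divr1.
  by have [_] := fP _ (Ev n); rewrite exprS invfM /=; lra.
have v_sum n : \sum_(i < n) f (v i) = y - v n.
  elim: n => [|n IHn]; first by rewrite big_ord0 subrr.
  by rewrite big_ord_recr/= IHn; abel.
rewrite mulrDl; apply: (@B_series _ (fun j => f (v j))).
- by rewrite mulr_ge0// hn_ge0.
- move=> j; have [Bf _] := fP _ (Ev j); apply: B_mono Bf.
  by rewrite -[c * hn y / _]mulrA ler_wpM2l.
- apply: (convergesP hn_norm (half_geometric_null (hn y))) => n.
  by rewrite v_sum addrC addKr hnN.
Qed.

End Gauge.

(** * Adjointable operators *)

Section Operators.
Context {R : realType} {A : cstarAlgType R} {H : hilbertModule A}.
Implicit Types (x y z : H) (r t e : R).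

(** The adjoint is part of the data, and linearity is a consequence of its
    existence. *)
Structure op := Op {
  op_fun :> H -> H ;
  op_adj : H -> H ;
  op_adjP : forall x y, ip (op_fun x) y = ip x (op_adj y) ;
  op_bound : exists2 C, 0 <= C & forall x, hn (op_fun x) <= C * hn x
}.

Lemma opD (f : op) x y : f (x + y) = f x + f y.
Proof.
by apply: ip_ext => z; rewrite ipDr -!(ip_st (f _)) !op_adjP ipDl stD.
Qed.

Lemma opZ (f : op) x a : f (mact x a) = mact (f x) a.
Proof.
by apply: ip_ext => z; rewrite ipZr -!(ip_st (f _)) !op_adjP ipZl stM stK.
Qed.

Lemma op0 (f : op) : f 0 = 0.
Proof. by apply: (addrI (f 0)); rewrite -opD !addr0. Qed.

Lemma opN (f : op) x : f (- x) = - f x.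
Proof. by apply/eqP; rewrite -addr_eq0 -opD addNr op0. Qed.

Lemma opB (f : op) x y : f (x - y) = f x - f y.
Proof. by rewrite opD opN. Qed.

Lemma op_sum (f : op) n (u : 'I_n -> H) :
  f (\sum_(i < n) u i) = \sum_(i < n) f (u i).
Proof. by elim/big_rec2: _ => [|i y x _ <-]; rewrite ?op0// opD. Qed.

Lemma op_scale (f : op) r x : f (hscale r x) = hscale r (f x).
Proof. exact: opZ. Qed.

Lemma op_adjPr (f : op) x y : ip y (f x) = ip (op_adj f y) x.
Proof. by rewrite -ip_st op_adjP ip_st. Qed.

Lemma op_converges (f : op) u l : converges hn u l -> converges hn (fun n => f (u n)) (f l).
Proof.
have [C C0 fC] := op_bound f => ul.
by apply: (convergesP hn_norm (null_scale C ul)) => n; rewrite -opB.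
Qed.

(** From |G y|^2 = |<F G y, y>| <= C |G y| |y|. *)
Lemma adjoint_bound (F G : H -> H) C : 0 <= C -> (forall x y, ip (F x) y = ip x (G y)) ->
  (forall x, hn (F x) <= C * hn x) -> forall y, hn (G y) <= C * hn y.
Proof.
move=> C0 FG FC y; have [->|Gy0] := eqVneq (hn (G y)) 0.
  by rewrite mulr_ge0// hn_ge0.
have {}Gy0 : 0 < hn (G y) by rewrite lt_neqAle eq_sym Gy0 hn_ge0.
rewrite -(ler_pM2l Gy0) -expr2 hn_sqr -FG (le_trans (ip_le _ _))//.
by rewrite mulrCA mulrA ler_wpM2r ?hn_ge0.
Qed.

Lemma op_adj_adjP (f : op) x y : ip (op_adj f x) y = ip x (f y).
Proof. by rewrite op_adjPr. Qed.

Lemma op_adj_bound (f : op) : exists2 C, 0 <= C & forall x, hn (op_adj f x) <= C * hn x.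
Proof.
by have [C C0 fC] := op_bound f; exists C => //; apply: adjoint_bound C0 (op_adjP f) fC.
Qed.

Definition adj (f : op) : op := Op (op_adj_adjP f) (op_adj_bound f).

Lemma adjP (f : op) x y : ip (f x) y = ip x (adj f y). Proof. exact: op_adjP. Qed.
Lemma adjPr (f : op) x y : ip x (f y) = ip (adj f x) y. Proof. exact: op_adjPr. Qed.

Fact comp_adjP (f g : op) x y : ip (f (g x)) y = ip x (adj g (adj f y)).
Proof. by rewrite !adjP. Qed.
Fact comp_bound (f g : op) : exists2 C, 0 <= C & forall x, hn (f (g x)) <= C * hn x.
Proof.
have [C C0 fC] := op_bound f; have [D D0 gD] := op_bound g.
exists (C * D) => [|x]; first exact: mulr_ge0.
by rewrite (le_trans (fC _))// -mulrA ler_wpM2l.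
Qed.
Definition op_comp (f g : op) := Op (comp_adjP f g) (comp_bound f g).

Fact sub_adjP (f g : op) x y : ip (f x - g x) y = ip x (adj f y - adj g y).
Proof. by rewrite ipBl ipBr !adjP. Qed.
Fact sub_bound (f g : op) : exists2 C, 0 <= C & forall x, hn (f x - g x) <= C * hn x.
Proof.
have [C C0 fC] := op_bound f; have [D D0 gD] := op_bound g.
exists (C + D) => [|x]; first exact: addr_ge0.
by rewrite (le_trans (hnB _ _))// mulrDl lerD.
Qed.
Definition op_sub (f g : op) := Op (sub_adjP f g) (sub_bound f g).

Fact id_bound : exists2 C, 0 <= C & forall x, hn x <= C * hn x.
Proof. by exists 1 => // x; rewrite mul1r. Qed.
Definition op_id := Op (fun x y => erefl (ip x y)) id_bound.

Fact scale_adjP r x y : ip (hscale r x) y = ip x (hscale r y).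
Proof. by rewrite ipZl ipZr stZ st1 -scaleAl -scaleAr mul1r mulr1. Qed.
Fact scale_bound r : exists2 C, 0 <= C & forall x, hn (hscale r x) <= C * hn x.
Proof. by exists `|r| => // x; rewrite hn_hscale. Qed.
Definition op_hscale r := Op (scale_adjP r) (scale_bound r).

Lemma summable_converges (x : nat -> H) r : 0 <= r -> (forall i, hn (x i) <= r / 2 ^+ i) ->
  exists2 l, converges hn (fun n => \sum_(i < n) x i) l & hn l <= r + r.
Proof.
move=> r0 xr; pose s n := \sum_(i < n) x i.
have s_tail n m : (n <= m)%N -> hn (s m - s n) <= (r + r) / 2 ^+ n.
  move=> /subnKC <-; move: (m - n)%N => k.
  apply: (@le_trans _ _ ((r + r) / 2 ^+ n - (r + r) / 2 ^+ (n + k))); last first.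
    by rewrite gerBl divr_ge0 ?addr_ge0// exprn_ge0.
  elim: k => [|k IHk]; first by rewrite addn0 !subrr hn0.
  rewrite addnS /s big_ord_recr/= -/(s (n + k)%N) addrAC (le_trans (hnD _ _))//.
  by have := xr (n + k)%N; rewrite exprS invfM; lra.
have [l sl] := hm_complete (half_geometric_null (r + r)) s_tail.
exists l => //; have := converges_tail_le hn_norm sl (s_tail 0%N).
by rewrite /s big_ord0 subr0 expr0 divr1.
Qed.

Definition range_of (f : op) y := exists x, y = f x.

(** The size of y is the norm of a preimage. *)
Lemma open_range (U : op) : hlim_closed (range_of U) ->
  exists2 C, 0 <= C & forall y, range_of U y -> exists2 x, y = U x & hn x <= C * hn y.
Proof.
move=> closedU; pose B r y := exists2 x, y = U x & hn x <= r.
apply: (@gauge_bounded R A H (range_of U) B) => //.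
- by move=> _ _ [x ->] [y ->]; exists (x - y); rewrite opB.
- by move=> r _ [x ->]; exists (hscale r x); rewrite op_scale.
- by move=> r _ [x -> _]; exists x.
- by move=> r t _ rt [x -> xr]; exists x => //; apply: le_trans rt.
- move=> r t _ _ [x -> xr] [y -> yt]; exists (x - y); first by rewrite opB.
  by rewrite (le_trans (hnB _ _))// lerD.
- move=> c r _ c0 [x -> xr]; exists (hscale c x); first by rewrite op_scale.
  by rewrite hn_hscale ger0_norm// ler_wpM2l.
- by move=> _ [x ->]; exists (hn x), x.
- move=> r b y r0 bB by_.
  have [x xP] : {x & forall i, b i = U (x i) /\ hn (x i) <= r / 2 ^+ i}.
    apply: (choice (P := fun i x => b i = U x /\ hn x <= r / 2 ^+ i)) => i.
    by have [x] := bB i; exists x.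
  have [l xl lr] := summable_converges r0 (fun i => (xP i).2).
  exists l => //; apply: (converges_unique hn_norm by_).
  have -> : (fun n => \sum_(i < n) b i) = (fun n => U (\sum_(i < n) x i)).
    by apply/funext => n; rewrite op_sum; apply: eq_bigr => i _; case: (xP i).
  exact: op_converges.
Qed.

Definition subspace (M : H -> Prop) :=
  [/\ exists x, M x, forall x y, M x -> M y -> M (x - y) & forall r x, M x -> M (hscale r x)].

(** The size of an element is the norm of its component in M. A series of
    elements whose components are summable converges to an element whose
    component is the sum of the components, because N is closed. *)
Lemma direct_sum_bounded (M N : H -> Prop) : subspace M -> subspace N ->
  hlim_closed M -> hlim_closed N -> (forall x, exists m n, [/\ M m, N n & x = m + n]) ->
  (forall x, M x -> N x -> x = 0) ->
  exists2 C, 0 <= C & forall m n, M m -> N n -> hn m <= C * hn (m + n).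
Proof.
move=> [[m0 Mm0] Msub Mscale] [_ Nsub Nscale] Mcl Ncl MN MN0.
have M0 : M 0 by rewrite -(subrr m0); apply: (Msub).
have MD x y : M x -> M y -> M (x + y).
  by move=> Mx My; rewrite -[y]opprK -[- y]sub0r; apply/(Msub _ _ Mx)/Msub.
pose B r x := exists2 m, M m /\ N (x - m) & hn m <= r.
have [C C0 CB] : exists2 C, 0 <= C & forall x, True -> B (C * hn x) x.
  apply: (@gauge_bounded R A H (fun=> True) B) => //.
  - by move=> r t x rt [m Mm mr]; exists m => //; apply: le_trans rt.
  - move=> r t x y [m [Mm Nx] mr] [m' [Mm' Ny] mt]; exists (m - m').
      split; first exact: Msub.
      by rewrite (_ : _ - _ = (x - m) - (y - m')); [exact: Nsub | abel].
    by rewrite (le_trans (hnB _ _))// lerD.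
  - move=> c r x c0 [m [Mm Nx] mr]; exists (hscale c m).
      by rewrite -hscaleB; split; [exact: Mscale|exact: Nscale].
    by rewrite hn_hscale ger0_norm// ler_wpM2l.
  - move=> x _; have [m [n [Mm Nn ->]]] := MN x.
    by exists (hn m), m => //; rewrite addrC addKr.
  - move=> r b y r0 bB by_.
    have [m mP] : {m & forall i, (M (m i) /\ N (b i - m i)) /\ hn (m i) <= r / 2 ^+ i}.
      apply: (choice (P := fun i m => (M m /\ N (b i - m)) /\ hn m <= r / 2 ^+ i)) => i.
      by have [m] := bB i; exists m.
    have [l ml lr] := summable_converges r0 (fun i => (mP i).2).
    exists l => //; split.
      apply: (hlim_closed_converges Mcl _ ml) => n.
      by elim/big_rec: _ => // i x _ Mx; apply: MD => //; case: (mP i) => -[].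
    apply: (hlim_closed_converges Ncl _ (convergesB hn_norm by_ ml)) => n.
    rewrite -sumrB; elim: n => [|n IHn].
      rewrite big_ord0; have [_ N0] := (mP 0%N).1.
      by rewrite -(subrr (b 0%N - m 0%N)); apply: (Nsub).
    rewrite big_ord_recr/= -[b n - m n]opprK; apply: (Nsub) => //.
    have [_ Nn] := (mP n).1; rewrite -sub0r; apply: (Nsub) => //.
    by rewrite -(subrr (b n - m n)); apply: (Nsub).
exists C => // m n Mm Nn; have [m' [Mm' Nn'] le] := CB (m + n) I.
suff e : m = m' by rewrite {1}e.
apply/subr0_eq/MN0; first exact: Msub.
by rewrite (_ : m - m' = (m + n - m') - n); [exact: Nsub | abel].
Qed.

End Operators.

(** * Operators with closed range *)

Section ClosedRange.
Context {R : realType} {A : cstarAlgType R} {H : hilbertModule A}.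
Implicit Types (x y z : H) (r t e : R).

Section Contraction.
Variable T : H -> H.
Hypothesis T_sa : forall x y, ip (T x) y = ip x (T y).
Hypothesis T_pos : forall x, pos (ip x (T x)).
Hypothesis T_le1 : forall x, hn (T x) <= hn x.

Let iter_sa n x y : ip (iter n T x) y = ip x (iter n T y).
Proof. by elim: n x y => // n IHn x y; rewrite iterS T_sa IHn -iterSr. Qed.

Let TD x y : T (x - y) = T x - T y.
Proof. by apply: ip_ext => z; rewrite ipBr -!T_sa ipBr. Qed.

(** Since 2 <x, Sx> <= <x, x> + <x, S^2 x> for self-adjoint S, repeated squaring
    of S = T gives <x, Tx> <= (1 - 2^-m) <x, x> + 2^-m <x, T^(2^m) x>; the last
    term tends to zero as T is contractive. *)
Lemma contraction_form_le x : pos (ip x x - ip x (T x)).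
Proof.
pose S m := iter (2 ^ m) T.
have le_step m : pos (ip x x + ip x (S m.+1 x) - (ip x (S m x) + ip x (S m x))).
  have -> : ip x (S m.+1 x) = ip (S m x) (S m x).
    by rewrite iter_sa -iterD addnn -mul2n -expnS.
  have := ip_pos (x - S m x); rewrite ipBr !ipBl [ip (S m x) x]iter_sa -/(S m).
  by congr pos; abel.
have le_m m : pos ((1 - 1 / 2 ^+ m) *: ip x x + (1 / 2 ^+ m) *: ip x (S m x) - ip x (T x)).
  elim: m => [|m IHm].
    rewrite expr0 divr1 subrr scale0r add0r scale1r subrr; exact: pos0.
  have c0 : 0 <= 1 / 2 ^+ m.+1 :> R by rewrite divr_ge0// exprn_ge0.
  have := posD IHm (posZ c0 (le_step m)); congr pos.
  have -> : 1 / 2 ^+ m = 1 / 2 ^+ m.+1 + 1 / 2 ^+ m.+1 :> R by rewrite exprS invfM; lra.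
  set c := 1 / _; rewrite scalerBr !scalerDr !scalerDl !scaleNr !scalerDl; abel.
have S_le m : hn (S m x) <= hn x.
  by rewrite /S; elim: (2 ^ m)%N => // n IHn; rewrite iterS (le_trans (T_le1 _)).
apply: pos_converges le_m _.
apply: (convergesP nm_group_norm (half_geometric_null (hn x ^+ 2 + hn x ^+ 2))) => m.
set c := 1 / _; have c0 : 0 <= c by rewrite divr_ge0// exprn_ge0.
have -> : (1 - c) *: ip x x + c *: ip x (S m x) - ip x (T x) - (ip x x - ip x (T x)) =
    c *: (ip x (S m x) - ip x x) by rewrite scalerBr scalerBl scale1r; abel.
rewrite nmZ ger0_norm// mulrC /c div1r ler_wpM2r ?invr_ge0 ?exprn_ge0//.
rewrite (le_trans (nmB _ _))// hn_sqr lerD2r (le_trans (ip_le _ _))// -hn_sqr expr2.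
by rewrite ler_wpM2l ?hn_ge0.
Qed.

Definition defect x := x - T x.

Let defect_sa x y : ip (defect x) y = ip x (defect y).
Proof. by rewrite ipBl ipBr T_sa. Qed.

Let iter_defect_sa n x y : ip (iter n defect x) y = ip x (iter n defect y).
Proof. by elim: n x y => // n IHn x y; rewrite iterS defect_sa IHn -iterSr. Qed.

Let T_defect n x : T (iter n defect x) = iter n defect (T x).
Proof. by elim: n => // n IHn; rewrite !iterS /defect TD IHn. Qed.

Let iter_defectB n x y : iter n defect (x - y) = iter n defect x - iter n defect y.
Proof. by elim: n => // n IHn; rewrite !iterS IHn /defect TD; abel. Qed.

Lemma pos_iter_defect n x : pos (ip x (iter n defect x)).
Proof.
rewrite -(odd_double_half n) -addnn addnCA iterD -iter_defect_sa.
case: (odd n) => /=; last exact: ip_pos.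
by rewrite ipBr; apply: contraction_form_le.
Qed.

(** The forms f_l = <x, (1 - T)^l T x> decrease with l and telescope to <x, x> -
    <x, (1 - T)^(L + 1) x>, so that (L + 1) f_L <= <x, x>. For L = 2n the form
    f_L is <(1 - T)^n x, T (1 - T)^n x>. *)
Lemma iter_defect_decay n x :
  n.*2.+1%:R * nm (ip (iter n defect x) (T (iter n defect x))) <= hn x ^+ 2.
Proof.
pose f n := ip x (iter n defect (T x)).
have f_sub m : f m - f m.+1 = ip (T x) (iter m defect (T x)).
  by rewrite /f iterSr {2}/defect iter_defectB ipBr T_sa T_defect; abel.
have pos_sum m : pos (ip x x - ip x (iter m.+1 defect x) - m.+1%:R *: f m).
  elim: m => [|m IHm].
    by rewrite scale1r /f /= ipBr (_ : _ - _ = 0); [exact: pos0 | abel].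
  have := posD IHm (posZ (ler0n _ m.+1) (pos_iter_defect m (T x))).
  rewrite -f_sub; congr pos.
  have -> : ip x (iter m.+2 defect x) = ip x (iter m.+1 defect x) - f m.+1.
    by rewrite iterSr {1}/defect iter_defectB ipBr.
  by rewrite -[m.+2%:R]natr1 scalerDl scale1r scalerBr; abel.
have f_even : f n.*2 = ip (iter n defect x) (T (iter n defect x)).
  by rewrite /f -addnn iterD -iter_defect_sa T_defect.
rewrite -f_even hn_sqr -[n.*2.+1%:R]ger0_norm// -nmZ.
apply: nm_mono; first by apply: posZ => //; rewrite f_even.
rewrite (_ : _ - _ = (ip x x - ip x (iter n.*2.+1 defect x) - n.*2.+1%:R *: f n.*2)
  + ip x (iter n.*2.+1 defect x)); last by abel.
by apply: posD => //; apply: pos_iter_defect.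
Qed.

End Contraction.

(** If y = U x with |x| <= C |y|, then |y|^2 = |<x, U^* y>| <= C |y| |U^* y|. *)
Lemma closed_range_adj_bounded_below (U : @op R A H) : hlim_closed (range_of U) ->
  exists2 C, 0 <= C & forall y, range_of U y -> hn y <= C * hn (adj U y).
Proof.
move=> /open_range[C C0 CU]; exists C => // y /[dup] Uy /CU[x yx xC].
have [/hn_eq0->|y0] := leP (hn y) 0; first by rewrite hn0 mulr_ge0 ?hn_ge0.
rewrite -(ler_pM2l y0) -expr2 hn_sqr {1}yx adjP (le_trans (ip_le _ _))//.
by rewrite mulrCA mulrA ler_wpM2r ?hn_ge0.
Qed.

Lemma null_sqrt_harmonic (D : R) : 0 <= D -> null (fun n => Num.sqrt (D / n.*2.+1%:R)).
Proof.
move=> D0; apply/nullP => [n|e e0]; first exact: sqrtr_ge0.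
have De0 : 0 <= D / e ^+ 2 by rewrite divr_ge0// sqr_ge0.
exists (Num.bound (D / e ^+ 2)) => n nb.
rewrite -(@ler_pXn2r _ 2)// ?nnegrE ?sqrtr_ge0 ?(ltW e0)// sqr_sqrtr ?divr_ge0//.
rewrite ler_pdivrMr ?ltr0Sn// mulrC -ler_pdivrMr ?exprn_gt0//.
apply: le_trans (ltW (archi_boundP De0)) _; rewrite ler_nat (leq_trans nb)//.
by rewrite -addnn -addnS leq_addr.
Qed.

(** On the range N of U, the operator T = U U^* is bounded below, and it is onto
    since (1 - T)^n tends to zero there: the partial sums of the Neumann series
    are Cauchy because T is bounded below. The map S that sends x to the s in N
    with T (T s) = T x, the inverse of T on N extended by zero on the orthogonal
    complement, is self-adjoint and bounded, and W = U^* S. *)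
Lemma closed_range_inverse_contraction (U : @op R A H) :
  (forall x, hn (U x) <= hn x) -> hlim_closed (range_of U) ->
  exists W : @op R A H, forall x, U (W (U x)) = U x.
Proof.
move=> U1 closedU; have U1' x : hn (adj U x) <= hn x.
  rewrite -[leRHS]mul1r; apply: adjoint_bound x => //; first exact: adjP.
  by move=> x; rewrite mul1r.
pose N := range_of U; pose T := op_comp U (adj U).
have NT x : N (T x) by exists (adj U x).
have NB x y : N x -> N y -> N (x - y).
  by move=> [u ->] [v ->]; exists (u - v); rewrite opB.
have T_sa x y : ip (T x) y = ip x (T y) by rewrite /= adjPr adjP.
have T_form x : ip x (T x) = ip (adj U x) (adj U x) by rewrite -[T x]/(U (adj U x)) adjPr.
have T_pos x : pos (ip x (T x)) by rewrite T_form; apply: ip_pos.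
have T1 x : hn (T x) <= hn x by rewrite (le_trans (U1 _)).
have [C C0 CU] := closed_range_adj_bounded_below closedU.
have CT y : N y -> hn y <= C ^+ 2 * hn (T y).
  move=> Ny; have [/hn_eq0->|y0] := leP (hn y) 0.
    by rewrite hn0 mulr_ge0 ?hn_ge0 ?sqr_ge0.
  rewrite -(ler_pM2l y0) -expr2; apply: (@le_trans _ _ ((C * hn (adj U y)) ^+ 2)).
    by rewrite lerXn2r ?nnegrE ?mulr_ge0 ?hn_ge0// CU.
  rewrite exprMn hn_sqr -T_form mulrCA ler_wpM2l ?sqr_ge0//.
  exact: ip_le.
have T_inj x y : N x -> N y -> T x = T y -> x = y.
  move=> Nx Ny Txy; apply/subr0_eq/hn_eq0; rewrite (le_trans (CT _ _))//; first exact: NB.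
  by rewrite opB Txy subrr hn0 mulr0.
pose Q := defect T.
have NQ n x : N x -> N (iter n Q x).
  by move=> Nx; elim: n => // n IHn; rewrite iterS; apply: NB.
have D0 x : 0 <= C ^+ 2 * hn x ^+ 2 by apply: mulr_ge0; apply: sqr_ge0.
have decay n x : N x -> hn (iter n Q x) <= Num.sqrt (C ^+ 2 * hn x ^+ 2 / n.*2.+1%:R).
  move=> Nx; rewrite -(@ler_pXn2r _ 2)// ?nnegrE ?sqrtr_ge0 ?hn_ge0//.
  rewrite [leRHS]sqr_sqrtr; last exact: divr_ge0 (D0 x) (ler0n _ _).
  rewrite ler_pdivlMr ?ltr0Sn//.
  apply: le_trans (ler_wpM2l (sqr_ge0 C) (iter_defect_decay T_sa T_pos T1 n x)).
  rewrite T_form -hn_sqr mulrCA mulrC -exprMn ler_wpM2l//.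
  by rewrite lerXn2r ?nnegrE ?mulr_ge0 ?hn_ge0// CU//; apply: NQ.
have T_onto x : N x -> exists2 s, N s & T s = x.
  move=> Nx; pose s m := \sum_(l < m) iter l Q x.
  have Ns m : N (s m).
    have [u uP] : exists u, forall l, iter l Q x = U (u l).
      have [u uP] := choice (fun l => NQ l x Nx); by exists u.
    exists (\sum_(l < m) u l); rewrite op_sum; apply: eq_bigr => l _; exact: uP.
  have Ts m : T (s m) = x - iter m Q x.
    elim: m => [|m IHm]; first by rewrite /s big_ord0 op0 subrr.
    have -> : s m.+1 = s m + iter m Q x by rewrite /s big_ord_recr.
    by rewrite opD IHm [iter m.+1 Q x]iterS {3}/Q /defect; abel.
  pose b m := Num.sqrt (C ^+ 2 * hn x ^+ 2 / m.*2.+1%:R).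
  have b0 : null b by apply: null_sqrt_harmonic.
  have s_tail n m : (n <= m)%N -> hn (s m - s n) <= C ^+ 2 * (b n + b n).
    move=> nm; rewrite (le_trans (CT _ (NB _ _ (Ns _) (Ns _))))// ler_wpM2l ?sqr_ge0//.
    rewrite opB !Ts (_ : _ - _ = iter n Q x - iter m Q x); last by abel.
    rewrite (le_trans (hnB _ _))// lerD// ?decay// (le_trans (decay _ _ Nx))//.
    rewrite ler_sqrt ?(divr_ge0 (D0 x))// ler_wpM2l//.
    by rewrite lef_pV2 ?posrE ?ltr0Sn// ler_nat ltnS leq_double.
  have [l sl] := hm_complete (null_scale (C ^+ 2) (null_add b0 b0)) s_tail.
  exists l; first exact: hlim_closed_converges closedU Ns sl.
  apply: (converges_unique hn_norm (op_converges T sl)).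
  apply: (convergesP hn_norm b0) => n.
  by rewrite Ts addrAC subrr add0r hnN decay.
have [S SP] : {S & forall x, N (S x) /\ T (T (S x)) = T x}.
  apply: (choice (P := fun x s => N s /\ T (T s) = T x)) => x.
  have [n Nn Tn] := T_onto _ (NT x); have [s Ns Ts] := T_onto _ Nn.
  by exists s; rewrite Ts Tn.
have S_sa x y : ip (S x) y = ip x (S y).
  have [s' Ns' Ts'] := T_onto _ (SP x).1; have [t' Nt' Tt'] := T_onto _ (SP y).1.
  rewrite -Ts' T_sa -(SP y).2 -!T_sa Ts' -Tt' -[RHS]T_sa -(SP x).2 Tt'.
  by rewrite [RHS]T_sa Tt'.
have S_bound : exists2 D, 0 <= D & forall x, hn (S x) <= D * hn x.
  exists (C ^+ 2 * C ^+ 2) => [|x]; first by rewrite mulr_ge0 ?sqr_ge0.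
  rewrite (le_trans (CT _ (SP x).1))// -mulrA ler_wpM2l ?sqr_ge0//.
  rewrite (le_trans (CT _ (NT _)))// ler_wpM2l ?sqr_ge0//.
  by rewrite (SP x).2.
exists (op_comp (adj U) (Op S_sa S_bound)) => x.
rewrite -/(T _) /=; apply: T_inj; [exact: NT|by exists x|].
exact: (SP (U x)).2.
Qed.

Lemma closed_range_inverse (U : @op R A H) : hlim_closed (range_of U) ->
  exists W : @op R A H, forall x, U (W (U x)) = U x.
Proof.
move=> closedU; have [C C0 UC] := op_bound U.
pose k := (C + 1)^-1; have k0 : 0 < k by rewrite invr_gt0; lra.
have [||W WP] := @closed_range_inverse_contraction (op_comp (op_hscale k) U).
- move=> x /=; rewrite hn_hscale gtr0_norm// /k ler_pdivrMl; last by lra.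
  by rewrite (le_trans (UC x))// ler_wpM2r ?hn_ge0//; lra.
- move=> l lU; have [x ->] : range_of U l.
    apply: closedU => e /lU[_ [x ->]]; exists (U (hscale k x)) => //; first by exists (hscale k x).
    by rewrite op_scale.
  by exists (hscale k^-1 x); rewrite /= op_scale hscaleA mulfV ?gt_eqF// hscale1.
exists (op_comp (op_hscale k) W) => x /=.
have kU : hscale k (U (hscale k^-1 x)) = U x.
  by rewrite op_scale hscaleA mulfV ?gt_eqF// hscale1.
by have := WP (hscale k^-1 x); rewrite /= kU op_scale.
Qed.

(** The range of F q is closed as F is bounded below on the closed range of q. A
    generalized inverse W of F q satisfies F q W F q = F q, where F can be
    cancelled on the range of q. *)
Lemma left_inverse_of_bounded_below (F q : @op R A H) C : 0 <= C ->
  (forall x, q (q x) = q x) -> (forall x, hn (q x) <= C * hn (F (q x))) ->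
  exists g : @op R A H, forall x, g (F (q x)) = q x.
Proof.
move=> C0 qq Fq; have F_inj x y : F (q x) = F (q y) -> q x = q y.
  move=> Fxy; apply/subr0_eq/hn_eq0; rewrite -opB (le_trans (Fq _))//.
  by rewrite !opB Fxy subrr hn0 mulr0.
have [|W WP] := @closed_range_inverse (op_comp F q).
  apply: hlim_closed_geometric => u l uP ul.
  have [x xP] := choice uP.
  have x_tail n m : (n <= m)%N -> hn (q (x m) - q (x n)) <= C * (2 / 2 ^+ n).
    move=> nm; rewrite -opB (le_trans (Fq _))// ler_wpM2l// !opB.
    rewrite -[F (q (x m))]/(op_comp F q (x m)) -[F (q (x n))]/(op_comp F q (x n)).
    rewrite -!xP (le_trans (gnorm_triangle hn_norm l _ _))//.
    rewrite [hn (l - _)](gnorm_distC hn_norm).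
    have le1 : 1 / 2 ^+ m <= 1 / 2 ^+ n :> R.
      by rewrite !div1r lef_pV2 ?posrE ?exprn_gt0// ler_weXn2l// ler1n.
    have := ul m; have := ul n; rewrite (_ : 2 / _ = 1 / 2 ^+ n + 1 / 2 ^+ n); lra.
  have [z xz] := hm_complete (null_scale C (half_geometric_null 2)) x_tail.
  have qz : q z = z.
    apply: (converges_unique hn_norm (op_converges q xz)).
    by rewrite (_ : (fun n => _) = fun n => q (x n))//; apply/funext => n; rewrite qq.
  exists z => /=; rewrite qz; apply: (converges_unique hn_norm (u := u)).
    exact: (convergesP hn_norm (half_geometric_null 1)).
  by rewrite (_ : u = fun n => F (q (x n)));
    [exact: op_converges|apply/funext => n; rewrite xP].
exists (op_comp q W) => x /=.
rewrite -[RHS]qq -[X in q (W X)]/(op_comp F q x).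
by rewrite (F_inj (W (op_comp F q x)) x)//; exact: WP.
Qed.

End ClosedRange.

(** * One-sided invertibility modulo finite rank *)

Section Fredholm.
Context {R : realType} {A : cstarAlgType R} {H : hilbertModule A}.
Local Notation op := (@op R A H).
Implicit Types (x y z : H) (r t e : R) (k : H -> H) (f g d : op).

Definition finite_rank k := exists n (g h : 'I_n -> H),
  forall x, k x = \sum_(i < n) mact (g i) (ip (h i) x).

Lemma finite_rank_ext k k' : (forall x, k x = k' x) -> finite_rank k -> finite_rank k'.
Proof. by move=> kk' [n [g [h kE]]]; exists n, g, h => x; rewrite -kk'. Qed.

Lemma finite_rankD k k' : finite_rank k -> finite_rank k' ->
  finite_rank (fun x => k x + k' x).
Proof.
move=> [n [g [h kE]]] [n' [g' [h' kE']]].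
pose glue (u : 'I_n -> H) (v : 'I_n' -> H) (i : 'I_(n + n')) :=
  match fintype.split i with inl j => u j | inr j => v j end.
have glueL u v i : glue u v (lshift n' i) = u i by rewrite /glue (unsplitK (inl i)).
have glueR u v i : glue u v (rshift n i) = v i by rewrite /glue (unsplitK (inr i)).
exists (n + n')%N, (glue g g'), (glue h h') => x; rewrite big_split_ord kE kE'.
by congr (_ + _); apply: eq_bigr => i _; rewrite ?glueL ?glueR.
Qed.

Lemma finite_rank_opl f k : finite_rank k -> finite_rank (fun x => f (k x)).
Proof.
move=> [n [g [h kE]]]; exists n, (f \o g), h => x.
by rewrite kE op_sum; apply: eq_bigr => i _; rewrite opZ.
Qed.

Lemma finite_rank_opr k f : finite_rank k -> finite_rank (fun x => k (f x)).
Proof.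
move=> [n [g [h kE]]]; exists n, g, (adj f \o h) => x.
by rewrite kE; apply: eq_bigr => i _; rewrite adjPr.
Qed.

Lemma finite_rankN k : finite_rank k -> finite_rank (fun x => - k x).
Proof.
move=> [n [g [h kE]]]; exists n, (fun i => - g i), h => x.
by rewrite kE -sumrN; apply: eq_bigr => i _; rewrite mactN.
Qed.

Lemma finite_rankB k k' : finite_rank k -> finite_rank k' ->
  finite_rank (fun x => k x - k' x).
Proof. by move=> kf kf'; apply: finite_rankD => //; apply: finite_rankN. Qed.

Lemma ip_suml n (u : 'I_n -> H) y : ip (\sum_(i < n) u i) y = \sum_(i < n) ip (u i) y.
Proof. by elim/big_rec2: _ => [|i z v _ <-]; rewrite ?ip0l// ipDl. Qed.

Lemma ip_sumr n (u : 'I_n -> H) y : ip y (\sum_(i < n) u i) = \sum_(i < n) ip y (u i).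
Proof. by elim/big_rec2: _ => [|i z v _ <-]; rewrite ?ip0r// ipDr. Qed.

Section RankOperator.
Variables (n : nat) (g h : 'I_n -> H).

Fact rank_adjP x y : ip (\sum_(i < n) mact (g i) (ip (h i) x)) y =
  ip x (\sum_(i < n) mact (h i) (ip (g i) y)).
Proof.
rewrite ip_suml ip_sumr; apply: eq_bigr => i _.
by rewrite ipZl ipZr ip_st.
Qed.

Lemma rank_bound x : hn (\sum_(i < n) mact (g i) (ip (h i) x)) <=
  (\sum_(i < n) hn (g i) * hn (h i)) * hn x.
Proof.
rewrite (le_trans (gnorm_sum hn_norm _ _ _))// mulr_suml ler_sum// => i _.
by rewrite (le_trans (hn_act _ _))// -mulrA ler_wpM2l ?hn_ge0// ip_le.
Qed.

Fact rank_op_bound : exists2 C, 0 <= C &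
  forall x, hn (\sum_(i < n) mact (g i) (ip (h i) x)) <= C * hn x.
Proof.
exists (\sum_(i < n) hn (g i) * hn (h i)); last exact: rank_bound.
by apply: sumr_ge0 => i _; rewrite mulr_ge0 ?hn_ge0.
Qed.

Definition rank_op := Op rank_adjP rank_op_bound.

End RankOperator.

Lemma finite_rank_adj f : finite_rank f -> finite_rank (adj f).
Proof.
move=> [n [g [h fE]]]; exists n, h, g => y; apply: ip_ext => z.
by rewrite -adjP fE rank_adjP.
Qed.

Definition left_invertible_mod f := exists g, finite_rank (fun x => x - g (f x)).
Definition right_invertible_mod f := exists g, finite_rank (fun x => x - f (g x)).

Lemma left_invertible_mod_adj f :
  right_invertible_mod f -> left_invertible_mod (adj f).
Proof.
move=> [g fg]; exists (adj g).
have := finite_rank_adj (f := op_sub op_id (op_comp f g)) fg.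
exact: finite_rank_ext.
Qed.

Lemma left_invertible_mod_comp f d : left_invertible_mod f ->
  left_invertible_mod d -> left_invertible_mod (op_comp d f).
Proof.
move=> [gf kf] [gd kd]; exists (op_comp gf gd).
apply: finite_rank_ext (finite_rankD kf (finite_rank_opl gf (finite_rank_opr f kd))) => x /=.
by rewrite opB; abel.
Qed.

Lemma right_invertible_mod_comp f d : right_invertible_mod f ->
  right_invertible_mod d -> right_invertible_mod (op_comp d f).
Proof.
move=> [gf kf] [gd kd]; exists (op_comp gf gd).
apply: finite_rank_ext (finite_rankD kd (finite_rank_opl d (finite_rank_opr gd kf))) => x /=.
by rewrite opB; abel.
Qed.

(** Modulo finite rank, d is left invertible with left inverse gd and has the
    right inverse f l. Hence f l and gd agree, so that f (l d) is the identity. *)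
Lemma right_invertible_factors f d : left_invertible_mod d ->
  right_invertible_mod (op_comp d f) -> right_invertible_mod d /\ right_invertible_mod f.
Proof.
move=> [gd kd] [l /= kl]; split; first by exists (op_comp f l).
exists (op_comp l d).
pose k1 := finite_rank_opl gd (finite_rank_opr d kl).
pose k2 := finite_rank_opr (op_comp f (op_comp l d)) kd.
apply: finite_rank_ext (finite_rankB (finite_rankD kd k1) k2) => x /=.
by rewrite opB; abel.
Qed.

(** The mirror image of the preceding lemma under taking adjoints. *)
Lemma left_invertible_factors f d : right_invertible_mod f ->
  left_invertible_mod (op_comp d f) -> left_invertible_mod d /\ left_invertible_mod f.
Proof.
move=> [rf kf] [l /= kl]; split; last by exists (op_comp l d).
exists (op_comp f l).
pose k1 := finite_rank_opl f (finite_rank_opr rf kl).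
pose k2 := finite_rank_opl (op_comp f (op_comp l d)) kf.
apply: finite_rank_ext (finite_rankB (finite_rankD kf k1) k2) => x /=.
by rewrite !opB; abel.
Qed.

Lemma null_sum n (b : 'I_n -> nat -> R) :
  (forall i, null (b i)) -> null (fun m => \sum_(i < n) b i m).
Proof.
elim: n b => [|n IHn] b b0.
  by rewrite (_ : (fun m => _) = fun=> 0); [exact: cvg_cst|apply/funext => m; rewrite big_ord0].
rewrite (_ : (fun m => _) = fun m => b ord0 m + \sum_(i < n) b (lift ord0 i) m).
  by apply: null_add => //; apply: IHn.
by apply/funext => m; rewrite big_ord_recl.
Qed.

(** For the standard module these are the projections on the first n
    coordinates. *)
Definition finite_rank_approximation (P : nat -> op) :=
  [/\ forall n, finite_rank (P n), forall n x, P n (P n x) = P n x,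
      forall n x y, ip (P n x) y = ip x (P n y)
    & forall x, converges hn (fun n => P n x) x].

(** Let g f = 1 - k and q = 1 - P n. Since |k q| is at most the sum of |u_i| |q
    v_i|, it is at most 1/2 for large n, so that f is bounded below on the range
    of q and g' f q = q for some g'. Then h = q g' works: by h f q = q,
    the operator 1 - h f factors through P n. *)
Lemma left_regularization P f : finite_rank_approximation P -> left_invertible_mod f ->
  exists h : op, (forall x, h (f (h x)) = h x) /\ finite_rank (fun x => x - h (f x)).
Proof.
move=> [Pfr Pidem Psa Pcvg] [g [N [u [v kE]]]].
pose b n := \sum_(i < N) hn (u i) * hn (v i - P n (v i)).
have b0 : null b.
  apply: null_sum => i; apply: null_scale.
  apply: null_squeeze (Pcvg (v i)) _ => n.
  by rewrite hn_ge0 /= (gnorm_distC hn_norm).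
have b_ge0 n : 0 <= b n by apply: sumr_ge0 => i _; rewrite mulr_ge0 ?hn_ge0.
have [|n /(_ n (leqnn n)) bn] := (nullP b_ge0).1 b0 2^-1; first by rewrite invr_gt0.
pose q := op_sub op_id (P n).
have qq x : q (q x) = q x by rewrite /q /= opB Pidem; abel.
have q_sa y z : ip (q y) z = ip y (q z) by rewrite /q /= ipBl ipBr Psa.
have k_small x : hn (q x - g (f (q x))) <= 2^-1 * hn (q x).
  rewrite kE (_ : \sum_(i < N) _ = \sum_(i < N) mact (u i) (ip (q (v i)) (q x))).
    exact: le_trans (rank_bound _ _ _) (ler_wpM2r (hn_ge0 _) bn).
  apply: eq_bigr => i _; congr mact.
  by rewrite [RHS]q_sa qq.
have [C C0 gC] := op_bound g.
have [g' g'P] : exists g' : op, forall x, g' (f (q x)) = q x.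
  apply: (@left_inverse_of_bounded_below _ _ _ f q (C + C)) => // [|x].
    exact: addr_ge0.
  have := k_small x; have := gC (f (q x)).
  have := gnorm_triangle hn_norm (q x) 0 (g (f (q x))).
  have := hnD (q x - g (f (q x))) (g (f (q x))); rewrite subrK.
  by lra.
exists (op_comp q g'); split=> [x|].
  by rewrite -[LHS]/(q (g' (f (q (g' x))))) g'P qq.
have k2 := finite_rank_opl (op_comp q (op_comp g' f)) (Pfr n).
apply: finite_rank_ext (finite_rankB (Pfr n) k2) => x.
have xE : x = P n x + q x by rewrite /q /=; abel.
have fx : f x = f (P n x) + f (q x) by rewrite -opD -xE.
have e : q (g' (f x)) = q (g' (f (P n x))) + q x 
  by rewrite fx 2!opD g'P qq.
have Px : P n x = x - q x by rewrite /q /=; abel.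
rewrite -[LHS]/(P n x - q (g' (f (P n x)))) -[RHS]/(x - q (g' (f x))) e.
by rewrite {1}Px; abel.
Qed.

Lemma right_regularization P f : finite_rank_approximation P -> right_invertible_mod f ->
  exists h : op, (forall x, h (f (h x)) = h x) /\ finite_rank (fun x => x - f (h x)).
Proof.
move=> approxP /left_invertible_mod_adj/(left_regularization approxP)[h [hfh hf]].
exists (adj h); split=> [x|].
  by apply: ip_ext => z; rewrite -!adjP adjPr -adjP hfh.
have := finite_rank_adj (f := op_sub op_id (op_comp h (adj f))) hf.
exact: finite_rank_ext.
Qed.

(** Modulo finite rank a right inverse of f agrees with the left inverse h, so
    the h of the left-sided case serves for both sides. *)
Lemma two_sided_regularization P f : finite_rank_approximation P ->
  left_invertible_mod f -> right_invertible_mod f ->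
  exists h : op, [/\ forall x, h (f (h x)) = h x,
    finite_rank (fun x => x - h (f x)) & finite_rank (fun x => x - f (h x))].
Proof.
move=> approxP /(left_regularization approxP)[h [hfh hf]] [g fg].
exists h; split=> //.
pose k1 := finite_rank_opl (op_comp f h) fg.
pose k2 := finite_rank_opl f (finite_rank_opr g hf).
apply: finite_rank_ext (finite_rankB (finite_rankD fg k2) k1) => x /=.
by rewrite !opB; abel.
Qed.

(** The vectors g_i are replaced by their images under p in order to lie in the
    range. *)
Lemma finite_rank_idempotent_range (p : op) : (forall x, p (p x) = p x) -> finite_rank p ->
  exists n (g : 'I_n -> H), forall x,
    p x = x <-> exists a : 'I_n -> calg A, x = \sum_(i < n) mact (g i) (a i).
Proof.
move=> pp [n [g [h pE]]]; exists n, (p \o g) => x; split=> [<-|[a ->]].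
  exists (fun i => ip (h i) x); rewrite -[LHS]pp [p x]pE op_sum.
  by apply: eq_bigr => i _; rewrite opZ.
by rewrite op_sum; apply: eq_bigr => i _; rewrite opZ /= pp.
Qed.

Section Decomposition.
Variables (f : op) (M1 N1 M2 N2 : H -> Prop).
Hypothesis f_M : forall x, M1 x -> M2 (f x).
Hypothesis f_N : forall x, N1 x -> N2 (f x).
Hypothesis direct1 : forall x, exists m n, [/\ M1 m, N1 n & x = m + n].
Hypothesis direct2 : forall x, exists m n, [/\ M2 m, N2 n & x = m + n].

(** With U W an idempotent onto N1, the kernel of U W is another complement of
    N1. Each x in it is the image under 1 - U W of its component m in M1, so |x|
    <= B |m| <= B C |f m|, and |f m| is bounded by |f x| because f m is the
    component of f x in M2. So f is bounded below on this kernel. *)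
Lemma left_invertible_mod_decomposition (U : op) C :
  subspace M2 -> subspace N2 -> hlim_closed M2 -> hlim_closed N2 ->
  (forall x, M2 x -> N2 x -> x = 0) ->
  0 <= C -> (forall x, M1 x -> hn x <= C * hn (f x)) ->
  finite_rank U -> hlim_closed N1 -> (forall x, N1 x <-> range_of U x) ->
  left_invertible_mod f.
Proof.
move=> subM2 subN2 clM2 clN2 M2N2 C0 fC Ufr clN1 N1U.
have clU : hlim_closed (range_of U).
  move=> l lU; apply/N1U/clN1 => e /lU[y yU le].
  by exists y => //; apply/N1U.
have [W UWU] := closed_range_inverse clU.
have [D D0 DM] := direct_sum_bounded subM2 subN2 clM2 clN2 direct2 M2N2.
pose q := op_sub op_id (op_comp U W).
have qq x : q (q x) = q x by rewrite /q /= !opB UWU; abel.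
have [B B0 qB] := op_bound q.
have [g gP] : exists g : op, forall x, g (f (q x)) = q x.
  apply: (@left_inverse_of_bounded_below _ _ _ f q (B * (C * D))) => // [|x].
    by rewrite !mulr_ge0.
  have [m [n [Mm Nn qx]]] := direct1 (q x).
  have qn : q n = 0 by move/N1U: Nn => [y ->]; rewrite /q /= UWU subrr.
  have -> : hn (q x) = hn (q m) by rewrite -qq qx opD qn addr0.
  rewrite qx opD -mulrA (le_trans (qB _))// ler_wpM2l// (le_trans (fC _ Mm))//.
  by rewrite -mulrA ler_wpM2l// DM//; [exact: f_M|exact: f_N].
exists g; have UW := finite_rank_opr W Ufr.
apply: finite_rank_ext (finite_rankB UW (finite_rank_opl (op_comp g f) UW)) => x /=.
have xE : x = q x + U (W x) by rewrite /q /= subrK.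
have -> : g (f x) = q x + g (f (U (W x))) by rewrite {1}xE 2!opD gP.
by rewrite /q /=; abel.
Qed.

(** With q = 1 - U W, which vanishes on N2, the operator q f maps onto the range
    of q, since M2 = f M1 maps onto it; hence q f has a generalized inverse V,
    and f V q is the identity up to U W. *)
Lemma right_invertible_mod_decomposition (U : op) :
  (forall y, M2 y -> exists2 x, M1 x & f x = y) ->
  finite_rank U -> hlim_closed N2 -> (forall x, N2 x <-> range_of U x) ->
  right_invertible_mod f.
Proof.
move=> f_onto Ufr clN2 N2U.
have clU : hlim_closed (range_of U).
  move=> l lU; apply/N2U/clN2 => e /lU[y yU le].
  by exists y => //; apply/N2U.
have [W UWU] := closed_range_inverse clU.
pose q := op_sub op_id (op_comp U W).
have qq x : q (q x) = q x by rewrite /q /= !opB UWU; abel.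
have q_range y : exists x, q y = q (f x).
  have [m [n [Mm /N2U[z ->] ->]]] := direct2 y; have [x _ <-] := f_onto _ Mm.
  by exists x; rewrite opD {2}/q /= UWU subrr addr0.
have [|V VP] := @closed_range_inverse _ _ _ (op_comp q f).
  apply: hlim_closed_geometric => u l uP ul.
  have ul' := convergesP hn_norm (half_geometric_null 1) ul.
  have ql : q l = l.
    apply: (converges_unique hn_norm (op_converges q ul')).
    rewrite (_ : (fun n => _) = u)//; apply/funext => n.
    by have [x ->] := uP n; exact: (qq (f x)).
  by have [x e] := q_range l; exists x; rewrite -[RHS]/(q (f x)) -e.
exists (op_comp V q).
have qfV y : q (f (V (q y))) = q y.
  have [x ->] := q_range y; exact: (VP x).
have UW := finite_rank_opr W Ufr.
apply: finite_rank_ext (finite_rankB UW (finite_rank_opr (op_comp f (op_comp V q)) UW)) => y.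
have := qfV y; rewrite /q /=.
move: (f (V (y - U (W y)))) => z; move: (U (W y)) (U (W z)) => b c e.
by rewrite -(subrK c z) e; abel.
Qed.

End Decomposition.

End Fredholm.

(** * The standard module as a Hilbert module *)

Section SquareSummable.
Context {R : realType} {A : cstarAlgType R}.
Local Notation T := (calg A).
Local Notation cseq := (nat -> T).
Implicit Types (x y z : cseq) (a b : T) (r e : R) (m n p q N : nat).

Definition cact x a : cseq := fun i => x i * a.

Definition fip m n x y : T := \sum_(m <= i < n) st (x i) * y i.

Lemma fip_semi m n : semi_inner_product cact (fip m n).
Proof.
split=> [x y z|x y a|x y|x]; rewrite /fip.
- by rewrite -big_split/=; apply: eq_bigr => i _; rewrite -mulrDr.
- by rewrite mulr_suml; apply: eq_bigr => i _; rewrite mulrA.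
- by rewrite linear_sum; apply: eq_bigr => i _; rewrite /= stM stK.
- by elim/big_rec: _ => [|i a _ posa]; [exact: pos0|apply: posD => //; exact: pos_star_mul].
Qed.

Definition fnorm m n x := semi_norm (fip m n) x.

Lemma fip_cat p m n x y : (p <= m <= n)%N -> fip p n x y - fip p m x y = fip m n x y.
Proof.
by move=> /andP[pm mn]; rewrite /fip (big_cat_nat pm mn)/=; abel.
Qed.

(** The Cauchy condition for the series of x_n^* x_n, phrased with the seminorms
    of finite segments, for which the triangle inequality is available. *)
Definition small_tails x := forall e, 0 < e ->
  exists N, forall m n, (N <= m <= n)%N -> fnorm m n x <= e.

Lemma small_tails_converges x y : small_tails x -> small_tails y ->
  exists l, converges nm (fun n => fip 0 n x y) l.
Proof.
move=> xs ys; apply: nm_complete_eps => e e0.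
have [N xN] := xs _ e0; have [M yM] := ys _ ltr01.
exists (maxn N M) => n m /andP[]; rewrite geq_max => /andP[Nn Mn] nm_.
rewrite fip_cat//; apply: le_trans (cauchy_schwarz (fip_semi _ _) _ _) _.
rewrite -[e]mulr1 ler_pM ?semi_norm_ge0//; first by apply: xN; rewrite Nn.
by apply: yM; rewrite Mn.
Qed.

Lemma fip_le_limit x l n : converges nm (fun n => fip 0 n x x) l ->
  pos (l - fip 0 n x x).
Proof.
move=> xl; apply: (@pos_converges _ _ (fun m => fip 0 (m + n) x x - fip 0 n x x)) => [m|].
  by rewrite fip_cat ?leq_addl//; exact: (sip_pos (fip_semi _ _)).
apply: (convergesB nm_group_norm); first exact: converges_shift xl.
exact: converges_cst nm_group_norm _.
Qed.

Lemma converges_small_tails x l : converges nm (fun n => fip 0 n x x) l -> small_tails x.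
Proof.
move=> xl e e0; move: (xl); rewrite /converges nullP => [|n]; last exact: nm_ge0.
move=> /(_ (e ^+ 2))[|N xN]; first exact: exprn_gt0.
exists N => m n /andP[Nm mn].
rewrite -(@ler_pXn2r _ 2)// ?nnegrE ?semi_norm_ge0 ?(ltW e0)// semi_norm_sqr.
apply: le_trans (xN m Nm); rewrite (gnorm_distC nm_group_norm).
apply: nm_mono; first exact: (sip_pos (fip_semi _ _)).
rewrite -(fip_cat (p := 0) _ _ (m := m)) ?mn//.
by rewrite opprB addrA subrK; apply: fip_le_limit.
Qed.

Lemma ell2P x : ell2 (x : nat -> A) <-> small_tails x.
Proof.
split=> [/cvg_ex[l xl]|xs].
  by apply: (@converges_small_tails _ l); apply/cvg_converges.
have [l /cvg_converges xl] := small_tails_converges xs xs.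
by apply/cvg_ex; exists l.
Qed.

Lemma hinner_converges x y : small_tails x -> small_tails y ->
  converges nm (fun n => fip 0 n x y) (hinner (x : nat -> A) y).
Proof.
move=> xs ys; have [l xyl] := small_tails_converges xs ys.
suff -> : hinner (x : nat -> A) y = l by [].
by apply: cvg_lim => //; apply/cvg_converges.
Qed.

Lemma small_tails0 : small_tails (0 : cseq).
Proof.
move=> e e0; exists 0%N => m n _.
by rewrite /fnorm/semi_norm /fip big1 ?nm0 ?sqrtr0 ?(ltW e0)// => i _; rewrite mulr0.
Qed.

Lemma small_tailsB x y : small_tails x -> small_tails y -> small_tails (x - y).
Proof.
move=> xs ys e e0; have e2 : 0 < e / 2 by rewrite divr_gt0.
have [N xN] := xs _ e2; have [M yM] := ys _ e2.
exists (maxn N M) => m n /andP[]; rewrite geq_max => /andP[Nm Mm] mn.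
rewrite (le_trans (semi_normD (fip_semi m n) _ _))// (semi_normN (fip_semi m n)).
have := xN m n; have := yM m n; rewrite Nm Mm mn /fnorm => /(_ isT) + /(_ isT).
by lra.
Qed.

Lemma small_tails_act x a : small_tails x -> small_tails (cact x a).
Proof.
move=> xs e e0; have a0 : 0 < nm a + 1 by rewrite ltr_wpDl// nm_ge0.
have [|N xN] := xs (e / (nm a + 1)); first by rewrite divr_gt0.
exists N => m n mn; rewrite (le_trans (semi_norm_act (fip_semi m n) _ _))//.
have := xN m n mn; rewrite ler_pdivlMr// => /(le_trans _); apply.
by rewrite ler_wpM2l ?semi_norm_ge0// lerDl.
Qed.

Definition square_summable : {pred cseq} := fun x => `[< ell2 (x : nat -> A) >].

Lemma square_summableP x : reflect (small_tails x) (x \in square_summable).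
Proof. by apply: (iffP (asboolP _)) => /ell2P. Qed.

Fact square_summable_closed : zmod_closed square_summable.
Proof.
split=> [|x y /square_summableP xs /square_summableP ys].
  exact/square_summableP/small_tails0.
exact/square_summableP/small_tailsB.
Qed.

HB.instance Definition _ := GRing.isZmodClosed.Build cseq square_summable
  square_summable_closed.

Record l2 := L2 { l2_seq :> cseq ; l2P : l2_seq \in square_summable }.

HB.instance Definition _ := [isSub for l2_seq].
HB.instance Definition _ := [Choice of l2 by <:].
HB.instance Definition _ := [SubChoice_isSubZmodule of l2 by <:].

End SquareSummable.

Section StandardHilbertModule.
Context {R : realType} {A : cstarAlgType R}.
Local Notation T := (calg A).
Local Notation cseq := (nat -> T).
Local Notation l2 := (@l2 R A).
Implicit Types (x y z : l2) (a b : T) (r e : R) (m n p q N : nat).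

Lemma l2_tails x : small_tails x.
Proof. exact/square_summableP/l2P. Qed.

Lemma l2_ext x y : (forall i, x i = y i) -> x = y.
Proof. by move=> xy; apply/val_inj/funext. Qed.

Definition l2_of (x : cseq) (xs : small_tails x) : l2 := L2 (introT (square_summableP x) xs).

Definition l2_act x a : l2 := l2_of (small_tails_act a (l2_tails x)).

Definition l2_ip x y : T := hinner (x : nat -> A) (y : nat -> A).

Lemma l2_ip_converges x y : converges nm (fun n => fip 0 n x y) (l2_ip x y).
Proof. exact: hinner_converges (l2_tails x) (l2_tails y). Qed.

Lemma l2_ip_lim x y l : converges nm (fun n => fip 0 n x y) l -> l2_ip x y = l.
Proof. exact: (converges_unique nm_group_norm (l2_ip_converges x y)). Qed.

Lemma l2_ipP : semi_inner_product l2_act l2_ip.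
Proof.
split=> [x y z|x y a|x y|x].
- apply: l2_ip_lim.
  rewrite (_ : (fun n => _) = fun n => fip 0 n x y + fip 0 n x z).
    by apply: (convergesD nm_group_norm); apply: l2_ip_converges.
  by apply/funext => n; rewrite -(sipDr (fip_semi 0 n)).
- apply: l2_ip_lim.
  rewrite (_ : (fun n => _) = fun n => fip 0 n x y * a).
    by apply: convergesM; [exact: l2_ip_converges|exact: converges_cst nm_group_norm _].
  by apply/funext => n; rewrite -(sipZr (fip_semi 0 n)).
- apply/esym/l2_ip_lim.
  rewrite (_ : (fun n => _) = fun n => st (fip 0 n x y)).
    by apply: converges_st; apply: l2_ip_converges.
  by apply/funext => n; rewrite (sip_st (fip_semi 0 n)).
- apply: pos_converges (l2_ip_converges x x) => n.
  exact: (sip_pos (fip_semi 0 n)).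
Qed.

Lemma fip_le_l2_ip m n x : nm (fip m n x x) <= nm (l2_ip x x).
Proof.
have [nm_|mn] := leqP n m; first by rewrite /fip big_geq// nm0 nm_ge0.
apply: (@le_trans _ _ (nm (fip 0 n x x))); last first.
  apply: nm_mono; first exact: (sip_pos (fip_semi 0 n)).
  exact: fip_le_limit (l2_ip_converges x x).
apply: nm_mono; first exact: (sip_pos (fip_semi m n)).
rewrite -(@fip_cat _ _ 0 m n) ?(ltnW mn)// opprB addrC subrK.
exact: (sip_pos (fip_semi 0 m)).
Qed.

Lemma l2_coord_le x i : nm (x i) <= semi_norm l2_ip x.
Proof.
rewrite -(@ler_pXn2r _ 2)// ?nnegrE ?semi_norm_ge0 ?nm_ge0// semi_norm_sqr -nmC.
apply: le_trans (fip_le_l2_ip i i.+1 x).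
by rewrite /fip big_nat1.
Qed.

Lemma l2_ip_definite x : l2_ip x x = 0 -> x = 0.
Proof.
move=> x0; apply: l2_ext => i; apply: nm_eq0.
by rewrite (le_trans (l2_coord_le x i))// /semi_norm x0 nm0 sqrtr0.
Qed.

Lemma fip_converges m n (u : nat -> cseq) (w : cseq) :
  (forall i, converges nm (fun k => u k i) (w i)) ->
  converges nm (fun k => fip m n (u k) (u k)) (fip m n w w).
Proof.
move=> uw; rewrite /fip; elim: (index_iota m n) => [|i s IHs].
  under eq_fun do rewrite big_nil.
  by rewrite big_nil; apply: (converges_cst nm_group_norm).
under eq_fun do rewrite big_cons.
rewrite big_cons; apply: (convergesD nm_group_norm) => //.
by apply: convergesM => //; apply: converges_st.
Qed.

(** The coordinatewise limit v of a Cauchy sequence u satisfies |v - u_n| <= b_n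
    on every finite segment, uniformly. So the tails of v are small, and v is
    the limit in norm. *)
Lemma l2_complete : norm_complete (semi_norm l2_ip).
Proof.
move=> u b b0 ub.
have b_ge0 n : 0 <= b n by apply: le_trans (ub n n (leqnn _)); apply: semi_norm_ge0.
have [v uv] : {v : cseq & forall i, converges nm (fun n => u n i) (v i)}.
  apply: (choice (P := fun i w => converges nm (fun n => u n i) w)) => i.
  apply: nm_complete b0 _ => n m nm_.
  exact: le_trans (l2_coord_le (u m - u n) i) (ub _ _ nm_).
have tail n p q : fnorm p q (v - u n) <= b n.
  rewrite -(@ler_pXn2r _ 2)// ?nnegrE ?semi_norm_ge0// semi_norm_sqr -[fip _ _ _ _]subr0.
  have cvg_w : converges nm (fun k => fip p q (u (k + n)%N - u n) (u (k + n)%N - u n))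
      (fip p q (v - u n) (v - u n)).
    apply: (@fip_converges p q (fun k => (u (k + n)%N : cseq) - u n)) => i.
    apply: (convergesB nm_group_norm); last exact: (converges_cst nm_group_norm).
    exact: (@converges_shift _ _ _ n (fun k => u k i)).
  apply: (converges_le nm_group_norm cvg_w (cvg_cst 0)) => k; rewrite subr0 addr0.
  apply: le_trans (fip_le_l2_ip p q (u (k + n)%N - u n)) _.
  by rewrite -semi_norm_sqr lerXn2r ?nnegrE ?semi_norm_ge0// ub// leq_addl.
have vs : small_tails v.
  move=> e e0; have e2 : 0 < e / 2 by rewrite divr_gt0.
  have [N /(_ N (leqnn N)) bN] := (nullP b_ge0).1 b0 _ e2.
  have [M uM] := l2_tails (u N) e2.
  exists M => m n mn; rewrite -[v](subrK (u N : cseq)).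
  rewrite (le_trans (semi_normD (fip_semi m n) _ _))//.
  by have := tail N m n; have := uM m n mn; rewrite /fnorm; lra.
exists (l2_of vs); apply: null_squeeze b0 _ => n; rewrite semi_norm_ge0/=.
rewrite -(semi_normN l2_ipP) opprB.
rewrite -(@ler_pXn2r _ 2)// ?nnegrE ?semi_norm_ge0// semi_norm_sqr -[l2_ip _ _]subr0.
apply: (converges_le nm_group_norm (l2_ip_converges _ _) (cvg_cst 0)) => q.
rewrite subr0 addr0.
have := tail n 0%N q; rewrite -(@ler_pXn2r _ 2)// ?nnegrE ?semi_norm_ge0//.
by rewrite semi_norm_sqr.
Qed.

Fact l2_actDl x y a : l2_act (x + y) a = l2_act x a + l2_act y a.
Proof. by apply: l2_ext => i; apply: mulrDl. Qed.
Fact l2_actDr x a b : l2_act x (a + b) = l2_act x a + l2_act x b.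
Proof. by apply: l2_ext => i; apply: mulrDr. Qed.
Fact l2_actA x a b : l2_act (l2_act x a) b = l2_act x (a * b).
Proof. by apply: l2_ext => i; apply/esym/mulrA. Qed.
Fact l2_act1 x : l2_act x 1 = x.
Proof. by apply: l2_ext => i; apply: mulr1. Qed.

Definition HA : hilbertModule A := HilbertModule l2_actDl l2_actDr l2_actA l2_act1
  l2_ipP l2_ip_definite l2_complete.

Definition unit_seq i : cseq := fun j => (i == j)%:R.

Fact unit_small_tails i : small_tails (unit_seq i).
Proof.
move=> e e0; exists i.+1 => m n /andP[im mn].
rewrite /fnorm/semi_norm /fip big_nat big1 ?nm0 ?sqrtr0 ?(ltW e0)// => j /andP[mj _].
by rewrite /unit_seq ltn_eqF ?mulr0// (leq_trans im).
Qed.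

Definition unit_vec i : HA := l2_of (unit_small_tails i).

Lemma ip_unit_vec i (x : HA) : ip (unit_vec i) x = x i.
Proof.
apply: l2_ip_lim; apply: (null_squeeze (b := fun n => if (n <= i)%N then nm (x i) else 0)).
  apply/nullP => [n|e e0]; first by case: ifP => // _; apply: nm_ge0.
  by exists i.+1 => n ni; rewrite leqNgt ni ltW.
move=> n; rewrite nm_ge0/= /fip big_mkord.
have [ni|ni] := leqP n i.
  rewrite big1 ?sub0r ?nmN// => j _.
  by rewrite /= /unit_seq gtn_eqF ?mulr0n ?linear0 ?mul0r// (leq_trans (ltn_ord j)).
rewrite (bigD1 (Ordinal ni))//= big1 => [|j].
  by rewrite /unit_seq eqxx st1 mul1r addr0 subrr nm0.
by rewrite -val_eqE/= /unit_seq eq_sym => /negbTE->; rewrite mulr0n linear0 mul0r.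
Qed.

Definition truncation n : @op R A HA :=
  rank_op (fun i : 'I_n => unit_vec i) (fun i : 'I_n => unit_vec i).

Lemma l2_sum_coord n (u : 'I_n -> HA) j : (\sum_(i < n) u i : HA) j = \sum_(i < n) u i j.
Proof. by elim/big_rec2: _ => // i y x _ <-. Qed.

Lemma truncation_coord n (x : HA) j : truncation n x j = if (j < n)%N then x j else 0.
Proof.
rewrite /truncation /= l2_sum_coord.
have coord i : (mact (unit_vec i) (ip (unit_vec i) x)) j = (i == j)%:R * x i.
  by rewrite ip_unit_vec.
under eq_bigr do rewrite coord.
case: ifP => [jn|/negbT nj].
  rewrite (bigD1 (Ordinal jn))//= eqxx mul1r big1 ?addr0// => i.
  by rewrite -val_eqE/= => /negbTE->; rewrite mul0r.
rewrite big1// => i _; rewrite ltn_eqF ?mul0r//.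
by rewrite (leq_trans (ltn_ord i))// leqNgt.
Qed.

Lemma truncation_approximation : finite_rank_approximation truncation.
Proof.
split=> [n|n x|n x y|x].
- by exists n, (fun i : 'I_n => unit_vec i), (fun i : 'I_n => unit_vec i).
- by apply: l2_ext => j; rewrite !truncation_coord; case: (j < n)%N.
- exact: rank_adjP.
- apply/nullP => [n|e e0]; first exact: hn_ge0.
  have [N xN] := l2_tails x e0.
  exists N => n Nn; apply: hn_le_sqr; first exact: ltW.
  rewrite -[ip _ _]subr0.
  apply: (converges_le nm_group_norm (l2_ip_converges _ _) (cvg_cst 0)) => q.
  rewrite subr0 addr0; set w := truncation n x - x.
  have w0 j : (j < n)%N -> w j = 0.
    by move=> jn; rewrite -[w j]/(truncation n x j - x j) truncation_coord jn subrr.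
  have wx j : (n <= j)%N -> w j = - x j.
    by move=> nj; rewrite -[w j]/(truncation n x j - x j) truncation_coord ltnNge nj sub0r.
  move: w w0 wx => w w0 wx; have [qn|nq] := leqP q n.
    rewrite /fip big_nat big1 ?nm0 ?sqr_ge0// => j /andP[_ jq].
    by rewrite w0 ?mulr0// (leq_trans jq).
  have -> : fip 0 q w w = fip n q x x.
    rewrite /fip (big_cat_nat (leq0n n) (ltnW nq))/= big_nat big1 ?add0r.
      rewrite big_nat [RHS]big_nat; apply: eq_bigr => j /andP[nj _].
      by rewrite wx// linearN/= mulNr mulrN opprK.
    by move=> j jn; rewrite w0 ?mulr0.
  rewrite -semi_norm_sqr lerXn2r ?nnegrE ?semi_norm_ge0 ?(ltW e0)//.
  by apply: xN; rewrite Nn ltnW.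
Qed.

End StandardHilbertModule.

(** * Semi-Fredholm operators on the standard module *)

Section Transfer.
Context {R : realType} {A : cstarAlgType R}.
Local Notation T := (calg A).
Local Notation hseq := (nat -> A).
Local Notation HA := (@HA R A).
Local Notation op := (@op R A HA).
Implicit Types (x y z : HA) (f g h e : op) (F D : hseq -> hseq) (M N : set hseq).

Definition to_seq (x : HA) : hseq := l2_seq x.

Lemma to_seq_inj x y : to_seq x = to_seq y -> x = y.
Proof. by move=> xy; apply: val_inj. Qed.

Lemma to_seq_ell2 x : ell2 (to_seq x).
Proof. by apply/ell2P; apply: l2_tails. Qed.
Arguments to_seq_ell2 x : clear implicits.

Lemma ell2_to_seq (u : hseq) : ell2 u -> exists x, u = to_seq x.
Proof. by move=> /ell2P us; exists (l2_of us). Qed.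

Lemma to_seqD x y : to_seq (x + y) = to_seq x + to_seq y. Proof. by []. Qed.
Lemma to_seqB x y : to_seq (x - y) = to_seq x - to_seq y. Proof. by []. Qed.
Lemma to_seq_act x (a : T) : to_seq (mact x a) = hact (to_seq x) a. Proof. by []. Qed.

Lemma to_seq_sum n (u : 'I_n -> HA) : to_seq (\sum_(i < n) u i) = \sum_(i < n) to_seq (u i).
Proof. by elim/big_rec2: _ => // i y x _ <-. Qed.

Lemma hnorm_to_seq x : hnorm (to_seq x) = (hn x)%:C.
Proof.
rewrite /hnorm -[hinner _ _]/(ip x x : A) normE -hn_sqr rmorphXn/= sqrCK//.
by rewrite lecR hn_ge0.
Qed.

Lemma hnorm_le x y (C : R[i]) : hnorm (to_seq y) <= C * hnorm (to_seq x) ->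
  hn y <= `|complex.Re C| * hn x.
Proof.
rewrite !hnorm_to_seq; case: C => a b /=; rewrite lecE/= => /andP[_].
rewrite mulr0 subr0 => /le_trans; apply.
by rewrite ler_wpM2r ?hn_ge0// ler_norm.
Qed.

(** Operators are functions on all sequences of which only the values on l^2
    matter; f is the operator on the Hilbert module with these values. *)
Definition lifts F f := forall x, F (to_seq x) = to_seq (f x).

Lemma lifts_comp F D f g : lifts F f -> lifts D g -> lifts (D \o F) (op_comp g f).
Proof. by move=> Ff Dg x; rewrite /= Ff Dg. Qed.

Lemma Ba_lifts F : Ba F -> exists f, lifts F f.
Proof.
move=> [Fell2 _ [C FC] [G Gell2 FG]].
have [f fP] : {f : HA -> HA & forall x, F (to_seq x) = to_seq (f x)}.
  apply: (choice (P := fun x y => F (to_seq x) = to_seq y)) => x.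
  exact/ell2_to_seq/Fell2/to_seq_ell2.
have [g gP] : {g : HA -> HA & forall x, G (to_seq x) = to_seq (g x)}.
  apply: (choice (P := fun x y => G (to_seq x) = to_seq y)) => x.
  exact/ell2_to_seq/Gell2/to_seq_ell2.
have fg x y : ip (f x) y = ip x (g y).
  rewrite -[LHS]/(hinner (to_seq (f x)) (to_seq y)) -fP FG; try exact: to_seq_ell2.
  by rewrite gP.
have fC : exists2 C', 0 <= C' & forall x, hn (f x) <= C' * hn x.
  exists `|complex.Re C| => // x; apply: hnorm_le.
  by rewrite -fP; apply/FC/to_seq_ell2.
by exists (Op fg fC).
Qed.

Lemma lifts_linear M F f : M `<=` ell2 -> lifts F f -> linear_on M F.
Proof.
move=> Mell2 Ff; split=> [u v /Mell2/ell2_to_seq[x ->] /Mell2/ell2_to_seq[y ->]|].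
  by rewrite -to_seqD !Ff opD.
move=> u a /Mell2/ell2_to_seq[x ->].
by rewrite -(@to_seq_act x a) !Ff opZ.
Qed.

Lemma lifts_bounded M F f : M `<=` ell2 -> lifts F f -> bounded_on M F.
Proof.
move=> Mell2 Ff; have [C C0 fC] := op_bound f.
exists C%:C => u /Mell2/ell2_to_seq[x ->].
by rewrite Ff !hnorm_to_seq -rmorphM lecR.
Qed.

Lemma lifts_Ba F f : lifts F f -> Ba F.
Proof.
move=> Ff; split.
- by move=> u /ell2_to_seq[x ->]; rewrite Ff; apply: to_seq_ell2.
- exact: lifts_linear Ff.
- exact: lifts_bounded Ff.
have [G GP] : {G : hseq -> hseq &
    forall u, ell2 u -> forall x, u = to_seq x -> G u = to_seq (adj f x)}.
  apply: (choice (P := fun u v => ell2 u -> forall x, u = to_seq x -> v = to_seq (adj f x))) => u.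
  have [/ell2_to_seq[x ux]|nu] := pselect (ell2 u); last by exists u.
  by exists (to_seq (adj f x)) => _ y; rewrite ux => /to_seq_inj ->.
exists G => [u us|u v /ell2_to_seq[x ->] /ell2_to_seq[y ->]].
  by have [x ux] := ell2_to_seq us; rewrite (GP _ us _ ux); apply: to_seq_ell2.
rewrite (GP _ _ y)//; last exact: to_seq_ell2.
by rewrite Ff; apply: (adjP f).
Qed.

Definition member M x := M (to_seq x).

Lemma closed_submodule_subspace M : closed_submodule M -> subspace (member M).
Proof.
move=> [[_ M0 MD MZ] _]; split.
- by exists 0.
- move=> x y Mx My; rewrite /member to_seqB; apply: MD => //.
  have -> : - to_seq y = hact (to_seq y) (- 1 : T).
    by apply/funext => i; rewrite -[RHS]/((y i : T) * (- 1)) mulrN1.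
  exact: MZ.
- by move=> r x Mx; apply: MZ.
Qed.

Lemma closed_submodule_closed M : closed_submodule M -> hlim_closed (member M).
Proof.
move=> [_ Mcl] x xM; apply: Mcl; first exact: to_seq_ell2.
move=> -[e i]; rewrite ltcE/= => /andP[/eqP-> /xM[y My xy]].
by exists (to_seq y) => //; rewrite -to_seqB hnorm_to_seq ltcR.
Qed.

Lemma direct_sum_exists M N : closed_submodule M -> closed_submodule N -> direct_sum M N ->
  forall x, exists m n, [/\ member M m, member N n & x = m + n].
Proof.
move=> [[Mell2 _ _ _] _] [[Nell2 _ _ _] _] MN x.
have [[u v] [[/= Mu Nv xuv] _]] := MN _ (to_seq_ell2 x).
have [m um] := ell2_to_seq (Mell2 _ Mu); have [n vn] := ell2_to_seq (Nell2 _ Nv).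
exists m, n; rewrite /member -um -vn; split=> //.
by apply: to_seq_inj; rewrite xuv um vn.
Qed.

Lemma direct_sum_disjoint M N : closed_submodule M -> closed_submodule N -> direct_sum M N ->
  forall x, member M x -> member N x -> x = 0.
Proof.
move=> [[_ M0 _ _] _] [[_ N0 _ _] _] MN x Mx Nx.
have [p [_ p_uniq]] := MN _ (to_seq_ell2 x).
have /p_uniq e1 : [/\ M (to_seq x, 0 : hseq).1, N (to_seq x, 0 : hseq).2
  & to_seq x = (to_seq x, 0 : hseq).1 + (to_seq x, 0 : hseq).2] by rewrite /= addr0.
have /p_uniq e2 : [/\ M (0 : hseq, to_seq x).1, N (0 : hseq, to_seq x).2
  & to_seq x = (0 : hseq, to_seq x).1 + (0 : hseq, to_seq x).2] by rewrite /= add0r.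
apply: to_seq_inj; have := etrans (esym e1) e2.
by move=> [-> _].
Qed.

(** The operator sends a sequence to the combination of the generators with its
    first k coordinates as coefficients. *)
Lemma finitely_generated_range N : closed_submodule N -> finitely_generated N ->
  exists2 U : op, finite_rank U & forall x, member N x <-> range_of U x.
Proof.
move=> [[Nell2 _ _ _] _] [k [g Ng]].
have gN i : N (g i).
  rewrite Ng; exists (fun j => (j == i)%:R : T).
  rewrite (bigD1 i)//= big1 => [|j /negbTE ->]; apply/funext => l.
    by rewrite eqxx addr0 -[RHS]/((g i l : T) * 1) mulr1.
  by rewrite -[LHS]/((g j l : T) * 0) mulr0.
have [gh ghP] : {gh : 'I_k -> HA & forall i, g i = to_seq (gh i)}.
  by apply: (choice (P := fun i x => g i = to_seq x)) => i; apply/ell2_to_seq/Nell2.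
pose U := rank_op gh (fun i => unit_vec i).
have UE (a : 'I_k -> T) : to_seq (\sum_(i < k) mact (gh i) (a i)) = \sum_(i < k) hact (g i) (a i).
  by rewrite to_seq_sum; apply: eq_bigr => i _; rewrite ghP.
exists U => [|x]; first by exists k, gh, (fun i : 'I_k => unit_vec i).
rewrite /member Ng; split=> [[a xa]|[y ->]].
  exists (\sum_(j < k) mact (unit_vec j) (a j)); apply: to_seq_inj.
  rewrite xa -UE; congr to_seq; apply: eq_bigr => i _; congr mact.
  have coord (j : 'I_k) :
      ip (unit_vec i) (mact (unit_vec j) (a j : T)) = (j == i)%:R * (a j : T).
    by rewrite ip_unit_vec.
  rewrite -[RHS]/(ip (unit_vec i) (\sum_(j < k) mact (unit_vec j) (a j : T))).
  rewrite ip_sumr (bigD1 i)// coord eqxx mul1r big1 => [|j ji]; first exact/esym/addr0.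
  by rewrite coord (negbTE ji) mul0r.
by exists (fun i : 'I_k => ip (unit_vec i) y : T); rewrite -UE.
Qed.

Lemma decomposition_left_invertible F f M1 N1 M2 N2 : lifts F f ->
  decomposition F M1 N1 M2 N2 -> finitely_generated N1 -> left_invertible_mod f.
Proof.
move=> Ff [[cM1 cN1 cM2 cN2] MN1 MN2 FN [[FM _ _] _ _ [C FC]]] fgN1.
have [U Ufr N1U] := finitely_generated_range cN1 fgN1.
apply: (@left_invertible_mod_decomposition _ _ _ f (member M1) (member N1)
    (member M2) (member N2) _ _ _ _ U `|complex.Re C|) => //.
- by move=> x Mx; rewrite /member -Ff; apply: FM.
- by move=> x Nx; rewrite /member -Ff; apply: FN.
- exact: direct_sum_exists.
- exact: direct_sum_exists.
- exact: closed_submodule_subspace.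
- exact: closed_submodule_subspace.
- exact: closed_submodule_closed.
- exact: closed_submodule_closed.
- exact: direct_sum_disjoint.
- by move=> x Mx; apply: hnorm_le; rewrite -Ff; apply: FC.
- exact: closed_submodule_closed.
Qed.

Lemma decomposition_right_invertible F f M1 N1 M2 N2 : lifts F f ->
  decomposition F M1 N1 M2 N2 -> finitely_generated N2 -> right_invertible_mod f.
Proof.
move=> Ff [[cM1 cN1 cM2 cN2] MN1 MN2 FN [[FM _ FM_onto] _ _ _]] fgN2.
have [U Ufr N2U] := finitely_generated_range cN2 fgN2.
apply: (@right_invertible_mod_decomposition _ _ _ f (member M1)
    (member M2) (member N2) _ U) => //.
- exact: direct_sum_exists.
- move=> y My; have [u Mu uy] := FM_onto _ My.
  have [[M1ell2 _ _ _] _] := cM1; have [x ux] := ell2_to_seq (M1ell2 _ Mu).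
  exists x; first by rewrite /member -ux.
  by apply: to_seq_inj; rewrite -Ff -ux.
- exact: closed_submodule_closed.
Qed.

(** For an idempotent e this is its range, and the kernel of e is the fixed set
    of 1 - e. *)
Definition fixed_set e : set hseq := [set u | exists2 x, u = to_seq x & e x = x].

Lemma fixed_set_ell2 e : fixed_set e `<=` ell2.
Proof. by move=> _ [x -> _]; apply: to_seq_ell2. Qed.

Lemma fixed_set_closed_submodule e : closed_submodule (fixed_set e).
Proof.
split; first split.
- exact: fixed_set_ell2.
- by exists 0 => //; apply: op0.
- by move=> _ _ [x -> ex] [y -> ey]; exists (x + y) => //; rewrite opD ex ey.
- by move=> _ a [x -> ex]; exists (mact x a) => //; rewrite opZ ex.
move=> _ /ell2_to_seq[x ->] xe; exists x => //.
apply: (@hlim_closed_geometric R A HA (fun x => e x = x)) => [u l eu ul|d d0].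
  have {}ul := convergesP hn_norm (half_geometric_null 1) ul.
  apply: (converges_unique hn_norm (op_converges e ul)).
  by rewrite (_ : (fun n => _) = u)//; apply/funext => n; apply: eu.
have [|_ [y -> ey]] := xe d%:C; first by rewrite ltcR.
by rewrite -to_seqB hnorm_to_seq ltcR; exists y.
Qed.

Lemma fixed_set_direct_sum e : (forall x, e (e x) = e x) ->
  direct_sum (fixed_set e) (fixed_set (op_sub op_id e)).
Proof.
move=> ee _ /ell2_to_seq[x ->]; exists (to_seq (e x), to_seq (x - e x)); split.
  split=> /=.
  - by exists (e x).
  - by exists (x - e x) => //; rewrite /= !opB ee; abel.
  - by rewrite -[RHS]/(to_seq (e x + (x - e x))) addrC subrK.
move=> [_ _] [/= [y -> ey] [z -> ez]]; rewrite -to_seqD => /to_seq_inj ->.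
have ez0 : e z = 0 by rewrite -(subKr z (e z)) [z - e z]ez subrr.
by rewrite opD ey ez0 addr0 addrC addKr.
Qed.

Lemma fixed_set_finitely_generated e : (forall x, e (e x) = e x) -> finite_rank e ->
  finitely_generated (fixed_set e).
Proof.
move=> ee /(finite_rank_idempotent_range ee)[n [g eP]].
exists n, (fun i => to_seq (g i)); apply/seteqP; split=> [_ [x -> /eP[a ->]]|_ [a ->]] /=.
  by exists a; rewrite to_seq_sum.
exists (\sum_(i < n) mact (g i) (a i : T)); first by rewrite to_seq_sum.
by apply/eP; exists a.
Qed.

(** The maps f and h are inverse to each other between the ranges of h f and f
    h. *)
Lemma outer_inverse_decomposition F f h : lifts F f -> (forall x, h (f (h x)) = h x) ->
  decomposition F (fixed_set (op_comp h f)) (fixed_set (op_sub op_id (op_comp h f)))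
    (fixed_set (op_comp f h)) (fixed_set (op_sub op_id (op_comp f h))).
Proof.
move=> Ff hfh; split; first by split; apply: fixed_set_closed_submodule.
- by apply: fixed_set_direct_sum => x; rewrite /= hfh.
- by apply: fixed_set_direct_sum => x; rewrite /= hfh.
- move=> _ [x -> ex]; exists (f x); first by rewrite Ff.
  have {}ex : x - h (f x) = x := ex.
  by rewrite -[LHS]/(f x - f (h (f x))) -opB ex.
split; first split.
- move=> _ [x -> ex]; exists (f x); first by rewrite Ff.
  by rewrite -[RHS]/(f x) -[in RHS]ex.
- move=> u v /set_mem[x -> /= ex] /set_mem[y -> /= ey].
  by rewrite !Ff => /to_seq_inj fxy; rewrite -ex -ey fxy.
- move=> _ [y -> ey]; exists (to_seq (h y)); last by rewrite Ff; congr to_seq.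
  by exists (h y) => //=; rewrite hfh.
- exact: lifts_linear (@fixed_set_ell2 _) Ff.
- exact: lifts_bounded (@fixed_set_ell2 _) Ff.
have [C C0 hC] := op_bound h.
exists C%:C => _ [x -> ex]; rewrite Ff !hnorm_to_seq -rmorphM lecR.
by rewrite -[x in leLHS]ex; apply: hC.
Qed.

Lemma outer_inverse_idempotent f h : (forall x, h (f (h x)) = h x) ->
  let p := op_sub op_id (op_comp h f) in let p' := op_sub op_id (op_comp f h) in
  (forall x, p (p x) = p x) /\ (forall x, p' (p' x) = p' x).
Proof. by move=> hfh p p'; split=> x /=; rewrite !opB hfh; abel. Qed.

Lemma MPhi_plusP F f : lifts F f -> MPhi_plus F <-> left_invertible_mod f.
Proof.
move=> Ff; split=> [[_ [M1 [N1 [M2 [N2 [dec fgN1]]]]]]|].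
  exact: decomposition_left_invertible dec fgN1.
move=> /(left_regularization (@truncation_approximation R A))[h [hfh hf]].
split; first exact: lifts_Ba Ff.
do 4 eexists; split; first exact: (outer_inverse_decomposition Ff hfh).
by apply: fixed_set_finitely_generated; first exact: (outer_inverse_idempotent hfh).1.
Qed.

Lemma MPhi_minusP F f : lifts F f -> MPhi_minus F <-> right_invertible_mod f.
Proof.
move=> Ff; split=> [[_ [M1 [N1 [M2 [N2 [dec fgN2]]]]]]|].
  exact: decomposition_right_invertible dec fgN2.
move=> /(right_regularization (@truncation_approximation R A))[h [hfh hf]].
split; first exact: lifts_Ba Ff.
do 4 eexists; split; first exact: (outer_inverse_decomposition Ff hfh).
by apply: fixed_set_finitely_generated; first exact: (outer_inverse_idempotent hfh).2.
Qed.

Lemma MPhiP F f : lifts F f ->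
  MPhi F <-> left_invertible_mod f /\ right_invertible_mod f.
Proof.
move=> Ff; split=> [[_ [M1 [N1 [M2 [N2 [dec fgN1 fgN2]]]]]]|[lf rf]].
  split; first exact: decomposition_left_invertible dec fgN1.
  exact: decomposition_right_invertible dec fgN2.
have [h [hfh hf fh]] := two_sided_regularization (@truncation_approximation R A) lf rf.
split; first exact: lifts_Ba Ff.
do 4 eexists; split; first exact: (outer_inverse_decomposition Ff hfh).
  by apply: fixed_set_finitely_generated; first exact: (outer_inverse_idempotent hfh).1.
by apply: fixed_set_finitely_generated; first exact: (outer_inverse_idempotent hfh).2.
Qed.

Lemma MPhi_plus_ideal : two_sided_ideal (@MPhi_plus R A) (@MPhi_plus R A `\` @MPhi R A).
Proof.
have mul : mul_semigroup (@MPhi_plus R A).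
  move=> F D PF PD; have [f Ff] := Ba_lifts PF.1; have [d Dd] := Ba_lifts PD.1.
  apply/(MPhi_plusP (lifts_comp Ff Dd))/left_invertible_mod_comp.
    exact/(MPhi_plusP Ff).
  exact/(MPhi_plusP Dd).
split=> [//||F D PF PD notMPhi]; first by move=> F [].
split; first exact: mul.
have [f Ff] := Ba_lifts PF.1; have [d Dd] := Ba_lifts PD.1.
move: (PF) (PD) => /(MPhi_plusP Ff) lf /(MPhi_plusP Dd) ld.
move=> /(MPhiP (lifts_comp Ff Dd))[_ /(right_invertible_factors ld)[rd rf]].
by case: notMPhi => [[_ nF]|[_ nD]]; [apply: nF; apply/(MPhiP Ff)|apply: nD; apply/(MPhiP Dd)].
Qed.

Lemma MPhi_minus_ideal : two_sided_ideal (@MPhi_minus R A) (@MPhi_minus R A `\` @MPhi R A).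
Proof.
have mul : mul_semigroup (@MPhi_minus R A).
  move=> F D PF PD; have [f Ff] := Ba_lifts PF.1; have [d Dd] := Ba_lifts PD.1.
  apply/(MPhi_minusP (lifts_comp Ff Dd))/right_invertible_mod_comp.
    exact/(MPhi_minusP Ff).
  exact/(MPhi_minusP Dd).
split=> [//||F D PF PD notMPhi]; first by move=> F [].
split; first exact: mul.
have [f Ff] := Ba_lifts PF.1; have [d Dd] := Ba_lifts PD.1.
move: (PF) (PD) => /(MPhi_minusP Ff) rf /(MPhi_minusP Dd) rd.
move=> /(MPhiP (lifts_comp Ff Dd))[/(left_invertible_factors rf)[ld lf] _].
by case: notMPhi => [[_ nF]|[_ nD]]; [apply: nF; apply/(MPhiP Ff)|apply: nD; apply/(MPhiP Dd)].
Qed.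

End Transfer.

Lemma ideal_semigroup (X : Type) (S I : set (X -> X)) :
  two_sided_ideal S I -> mul_semigroup I.
Proof. by move=> [_ IS SI] F D IF ID; apply: SI; [exact: IS|exact: IS|left]. Qed.

Theorem corollary2p10 (R : realType) (A : cstarAlgType R) :
  [/\ two_sided_ideal (@MPhi_plus R A) (@MPhi_plus R A `\` @MPhi R A),
      two_sided_ideal (@MPhi_minus R A) (@MPhi_minus R A `\` @MPhi R A),
      mul_semigroup (@MPhi_plus R A `\` @MPhi R A)
    & mul_semigroup (@MPhi_minus R A `\` @MPhi R A)].
Proof.
have plus := @MPhi_plus_ideal R A; have minus := @MPhi_minus_ideal R A.
by split=> //; apply: ideal_semigroup; [exact: plus|exact: minus].
Qed.
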